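(* Given a finite alphabet $\Sigma$ and a context-free grammar $G$ over terminal alphabet $\Sigma$, deciding whether $L(G)\cap E_\Sigma\neq\emptyset$ is in NP (with input size $|G|+|\Sigma|$).
   Context: For a finite alphabet $\Sigma$, a perfect pangram is a string over $\Sigma$ in which each letter of $\Sigma$ occurs exactly once; $E_\Sigma$ is the set of perfect pangrams. $|G|$ is the size of the grammar (total size of its rules). *)

(* Defs.v *)
From Stdlib Require Import Relations.
From mathcomp Require Import all_boot.
Set Implicit Arguments. Unset Strict Implicit. Unset Printing Implicit Defensive.

(* The alphabet Sigma with |Sigma| = s is identified with {0,...,s-1}.
   A grammar symbol is either a terminal [inl a] or a nonterminal [inr A]
   (nonterminals are named by natural numbers). *)
Definition sym := (nat + nat)%type.

Record cfg := CFG {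
  start : nat;
  rules : seq (nat * seq sym)
}.

Definition gsize (G : cfg) : nat := sumn [seq (size r.2).+1 | r <- rules G].

Definition over_alphabet (s : nat) (G : cfg) : bool :=
  all (fun r => all (fun x => if x is inl a then a < s else true) r.2) (rules G).

Definition derives1 (G : cfg) (u v : seq sym) : Prop :=
  exists (l r : seq sym) (A : nat) (rhs : seq sym),
    (A, rhs) \in rules G /\ u = l ++ inr A :: r /\ v = l ++ rhs ++ r.

Definition derives (G : cfg) := clos_refl_trans (seq sym) (derives1 G).

Definition in_lang (G : cfg) (w : seq nat) : Prop :=
  derives G [:: inr (start G)] [seq inl a | a <- w].

Definition perfect_pangram (s : nat) (w : seq nat) : bool :=
  all (fun a => a < s) w && all (fun a => count_mem a w == 1) (iota 0 s).

Definition unary (n : nat) : seq bool := rcons (nseq n true) false.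
Definition enc_nats (l : seq nat) : seq bool :=
  unary (size l) ++ flatten [seq unary n | n <- l].
Definition sym_nats (x : sym) : seq nat :=
  match x with inl a => [:: 0; a] | inr A => [:: 1; A] end.
Definition rule_nats (r : nat * seq sym) : seq nat :=
  r.1 :: size r.2 :: flatten [seq sym_nats x | x <- r.2].
Definition encode (s : nat) (G : cfg) : seq bool :=
  enc_nats (s :: start G :: size (rules G) :: flatten [seq rule_nats r | r <- rules G]).

Definition PANGRAM_CFG (x : seq bool) : Prop :=
  exists (s : nat) (G : cfg), x = encode s G /\ over_alphabet s G /\
    exists w, in_lang G w /\ perfect_pangram s w.

Inductive dir := MoveL | MoveR | Stay.

Record TM := {
  state : finType;
  tsym : finType;
  blank : tsym;
  (* input alphabet: [Some b] for bits, [None] for the separator *)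
  inp : option bool -> tsym;
  inp_inj : injective inp;
  blank_not_inp : forall c, inp c != blank;
  q0 : state;
  qacc : state;
  delta : state -> tsym -> state * tsym * dir
}.

Record config (M : TM) := Config {
  cstate : state M;
  cleft : seq (tsym M);   (* cells left of the head, nearest first *)
  chead : tsym M;
  cright : seq (tsym M)   (* cells right of the head, nearest first *)
}.

Definition step (M : TM) (c : config M) : config M :=
  let: @Config _ q l h r := c in
  if q == qacc M then c else
  let: (q', w, d) := @delta M q h in
  match d with
  | Stay => Config q' l w r
  | MoveL => Config q' (behead l) (head (blank M) l) (w :: r)
  | MoveR => Config q' (w :: l) (head (blank M) r) (behead r)
  end.

Definition init (M : TM) (x : seq (option bool)) : config M :=
  let t := map (inp M) x in Config (q0 M) [::] (head (blank M) t) (behead t).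

(* M accepts input x within t steps (the accepting state is halting). *)
Definition accepts_within (M : TM) (x : seq (option bool)) (t : nat) : bool :=
  cstate (iter t (@step M) (init M x)) == qacc M.

Definition in_NP (L : seq bool -> Prop) : Prop :=
  exists (M : TM) (c k : nat), forall x : seq bool,
    L x <-> exists y : seq bool,
      size y <= c * (size x) ^ k + c /\
      accepts_within M ([seq Some b | b <- x] ++ None :: [seq Some b | b <- y])
                     (c * (size x) ^ k + c).

(* Main.v *)
(** A certificate for [encode s G] is a list of numbers written in unary: the
positions of the rules, a word [w] of length [s] in which every letter occurs,
and a chart, i.e. a list of items "the right-hand side of rule [r] without its
first [t] symbols derives the letters [i, j) of [w]", each following in one
step from earlier ones.  There are polynomially many items, so a chart without
repetitions is short even when every derivation tree is exponentially large.

"The list certifies the input" is a first-order property, with counting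
quantifiers over tape positions, of the word input#certificate.  Such a formula
is evaluated in polynomial time by a machine that sweeps over the tape and keeps
the values of its variables as pebbles on the cells. *)

From Stdlib Require Import Relations.
Require Import Defs.
From mathcomp Require Import all_boot.
From mathcomp Require Import zify.
Set Implicit Arguments. Unset Strict Implicit. Unset Printing Implicit Defensive.

(** The machine has one tape and no arithmetic, so numbers have to live on the tape: a variable is a
    position, and unary coding keeps every field value and every field index below the tape length.
    Counting supplies the arithmetic: comparing a number of positions with a position gives
    addition, finds the field with a given index and reads off its value. Unary coding also bounds
    [s] by the input length, so that the word fits in the certificate.

    Two things have to be forced by the formula. The input must be exactly an encoding; this is why
    rule positions are guessed, since equations between consecutive positions then make parsing
    local. The chart must not be circular; this is why a justification may only use items of smaller
    index. Certificates of any length are sound, so their size matters for completeness only. *)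

(** * First-order formulas with counting *)

(* A quantifier at depth [d] binds variable [d].  [FoCount f k] says that the number of positions satisfying [f] is the value of variable [k], or 0 for [None]. *)
Inductive fo :=
| FoSym (c : option bool) (i : nat)
| FoLt (i j : nat)
| FoNot (f : fo)
| FoAnd (f g : fo)
| FoCount (f : fo) (k : option nat).

Definition upd (rho : nat -> nat) (d v : nat) : nat -> nat :=
  fun i => if eqn i d then v else rho i.

(** Everything is false off the tape. In particular the guard [n < size w] reflects that a counter
    which has reached [size w] has no cell left to be compared on. *)
Fixpoint sat (w : seq (option bool)) (d : nat) (rho : nat -> nat) (f : fo) : bool :=
  match f with
  | FoSym c i => (rho i < size w) && (nth None w (rho i) == c)
  | FoLt i j => rho i < rho j < size w
  | FoNot f => ~~ sat w d rho f
  | FoAnd f g => sat w d rho f && sat w d rho g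
  | FoCount f k =>
      let n := count (fun v => sat w d.+1 (upd rho d v) f) (iota 0 (size w)) in
      if k is Some k then (n == rho k) && (n < size w) else n == 0
  end.

Fixpoint wf (d : nat) (f : fo) : bool :=
  match f with
  | FoSym _ i => i < d
  | FoLt i j => (i < d) && (j < d)
  | FoNot f => wf d f
  | FoAnd f g => wf d f && wf d g
  | FoCount f k => wf d.+1 f && (if k is Some k then k < d else true)
  end.

Fixpoint qdepth (f : fo) : nat :=
  match f with
  | FoSym _ _ | FoLt _ _ => 0
  | FoNot f => qdepth f
  | FoAnd f g => maxn (qdepth f) (qdepth g)
  | FoCount f _ => (qdepth f).+1
  end.

Lemma eq_sat w d rho rho' f : wf d f -> (forall i, i < d -> rho i = rho' i) ->
  sat w d rho f = sat w d rho' f.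
Proof.
elim: f d rho rho' => [c i|i j|f IH|f IHf g IHg|f IH k] d rho rho' /=.
- by move=> lt_i ->.
- by case/andP=> lt_i lt_j e; rewrite !e.
- by move=> h e; rewrite (IH _ _ rho').
- by case/andP=> hf hg e; rewrite (IHf _ _ rho') // (IHg _ _ rho').
- case/andP=> hf hk e.
  have -> : count (fun v => sat w d.+1 (upd rho d v) f) (iota 0 (size w))
          = count (fun v => sat w d.+1 (upd rho' d v) f) (iota 0 (size w)).
    apply: eq_count => v; apply: IH => // i.
    rewrite ltnS /upd leq_eqVlt -[eqn i d]/(i == d); case: eqP => //= _; exact: e.
  by case: k hk => //= k /e ->.
Qed.

(** * Sweeping machines *)

Definition pstate : finType := (bool * bool)%type.

(** A control state in [spos] fixes what one left-to-right pass does, and two bits are all that a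
    pass remembers. This common memory lets machines be combined by disjoint sums of their control
    states. *)
Record sweep (G : finType) := Sweep {
  spos : finType;
  sstart : spos;
  spass : spos -> pstate -> G -> pstate * G;
  snext : spos -> pstate -> spos + bool
}.

Section Sweep.
Variable G : finType.
Implicit Type M : sweep G.

Fixpoint run_pass (f : pstate -> G -> pstate * G) (s : pstate) (T : seq G) :
    pstate * seq G :=
  if T is g :: T then
    let r := run_pass f (f s g).1 T in (r.1, (f s g).2 :: r.2)
  else (s, [::]).

Lemma run_pass_test (h : pstate -> G -> pstate) s T :
  run_pass (fun s g => (h s g, g)) s T = (foldl h s T, T).
Proof. by elim: T s => //= g T IH s; rewrite IH. Qed.

Lemma size_run_pass f s T : size (run_pass f s T).2 = size T.
Proof. by elim: T s => //= g T IH s; rewrite IH. Qed.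

Definition sstep M (c : (spos M + bool) * seq G) : (spos M + bool) * seq G :=
  if c.1 is inl p then
    let r := run_pass (spass p) (false, false) c.2 in (snext p r.1, r.2)
  else c.

Definition reaches M n c c' := exists2 k, k <= n & iter k (@sstep M) c = c'.

Lemma reaches_refl M n c : @reaches M n c c.
Proof. by exists 0. Qed.

Lemma reaches_trans M n1 n2 c1 c2 c3 :
  @reaches M n1 c1 c2 -> reaches n2 c2 c3 -> reaches (n1 + n2) c1 c3.
Proof.
move=> [k1 le1 <-] [k2 le2 <-]; exists (k2 + k1); first by rewrite addnC leq_add.
by rewrite iterD.
Qed.

Lemma reaches_step M n c1 c2 : @reaches M n (sstep c1) c2 -> reaches n.+1 c1 c2.
Proof. by case=> k le_k <-; exists k.+1; rewrite // iterSr. Qed.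

Lemma reaches_leq M n1 n2 c1 c2 : n1 <= n2 ->
  @reaches M n1 c1 c2 -> reaches n2 c1 c2.
Proof. by move=> le12 [k /leq_trans /(_ le12)]; exists k. Qed.

Lemma iter_sstep_exit M n b T : iter n (@sstep M) (inr b, T) = (inr b, T).
Proof. by elim: n => //= n ->. Qed.

(* A machine embedded in another one simulates it until it exits with [b], where control passes to [k b]. *)
Lemma reaches_embed M M' (io : spos M -> spos M') (k : bool -> spos M' + bool) :
  (forall p, spass (io p) = spass p) ->
  (forall p s, snext (io p) s =
     match snext p s with inl q => inl (io q) | inr b => k b end) ->
  forall n p T b T', @reaches M n (inl p, T) (inr b, T') ->
    @reaches M' n (inl (io p), T) (k b, T').
Proof.
move=> hpass hnext n p T b T' [j].
elim: j n p T => // j IH [|n] p T //; rewrite ltnS => le_jn.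
rewrite iterSr /sstep /=; case en: (snext p _) => [q|b'].
  move=> /(IH _ _ _ le_jn) h; apply: reaches_step.
  by rewrite /sstep /= hnext hpass en.
rewrite iter_sstep_exit => -[<- <-]; exists 1 => //.
by rewrite /= /sstep /= hpass hnext en.
Qed.

End Sweep.

(* Pebble [(i, b)] stands at position [m i b], and is off the tape when that exceeds the last cell; [b = false] for variable [i], [b = true] for the counter of the quantifier binding it. *)
Section Marks.
Variable K : nat.

Definition cell : finType := (option bool * {set 'I_K.+1 * bool})%type.

Definition mark (i : nat) (b : bool) (g : cell) : bool := (inord i, b) \in g.2.

Fixpoint mkoff (p : nat) (w : seq (option bool)) (m : nat -> bool -> nat) : seq cell :=
  if w is c :: w then
    (c, [set t : 'I_K.+1 * bool | m (val t.1) t.2 == p]) :: mkoff p.+1 w m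
  else [::].

Lemma markE i b c (m : nat -> bool -> nat) p : i <= K ->
  mark i b (c, [set t : 'I_K.+1 * bool | m (val t.1) t.2 == p]) = (m i b == p).
Proof. by move=> le_i; rewrite /mark inE /= inordK. Qed.

Definition h_sym c i (s : pstate) (g : cell) : pstate :=
  (s.1 || (mark i false g && (g.1 == c)), false).

Lemma h_symP c i s p w m : i <= K ->
  (foldl (h_sym c i) s (mkoff p w m)).1 =
  s.1 || [&& p <= m i false, m i false < p + size w & nth None w (m i false - p) == c].
Proof.
move=> le_i; elim: w s p => [|c' w IH] s p /=.
  by case: s.1 => //=; lia.
rewrite IH /h_sym /= markE //; set q := m i false.
case: s.1 => //=; case: (ltngtP q p) => [lt|lt|->] /=.
- by [].
- by rewrite addSnnS -(subnSK lt).
- by rewrite subnn /= orbF -{1}[p]addn0 ltn_add2l.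
Qed.

(** The second bit consults the old value of the first, so pebble [j] counts only strictly to the
    right of pebble [i]. *)
Definition h_lt i j (s : pstate) (g : cell) : pstate :=
  (s.1 || mark i false g, s.2 || (s.1 && mark j false g)).

Lemma h_ltP i j s p w m : i <= K -> j <= K ->
  (foldl (h_lt i j) s (mkoff p w m)).2 =
  s.2 || [&& p <= m j false, m j false < p + size w
           & s.1 || (p <= m i false < m j false)].
Proof.
move=> le_i le_j; elim: w s p => [|c' w IH] [a b] p /=.
  by case: b => //=; lia.
rewrite IH /h_lt /= !markE //; set u := m i false; set v := m j false.
case: a; case: b => //=; lia.
Qed.

(** The first bit means that the current cell is not the first one. The counter must share its cell
    with pebble [k], or stand on the first cell when it is compared with 0. *)
Definition h_cnt d k (s : pstate) (g : cell) : pstate :=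
  (true, s.2 || (mark d true g && (if k is Some k then mark k false g else ~~ s.1))).

Lemma h_cntP d k s p w m : d <= K -> (if k is Some k then k <= K else true) ->
  (foldl (h_cnt d k) s (mkoff p w m)).2 =
  s.2 || [&& p <= m d true, m d true < p + size w
           & if k is Some k then m k false == m d true else ~~ s.1 && (m d true == p)].
Proof.
move=> le_d le_k; elim: w s p => [|c' w IH] [a b] p /=.
  by case: b => //=; lia.
rewrite IH /h_cnt /= !markE //; case: k le_k {IH} => [k|] le_k.
  rewrite markE //; case: b => //=; lia.
by case: a; case: b => //=; lia.
Qed.

Definition f_reset d (s : pstate) (g : cell) : pstate * cell :=
  ((true, false), (g.1, [set t : 'I_K.+1 * bool |
     if t.1 == inord d then ~~ s.1 else t \in g.2])).

Lemma f_resetP d w m : d <= K ->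
  (run_pass (f_reset d) (false, false) (mkoff 0 w m)).2 =
  mkoff 0 w (fun i b => if i == d then 0 else m i b).
Proof.
move=> le_d; have eqd (t : 'I_K.+1) : (t == inord d) = (val t == d).
  by rewrite -val_eqE /= inordK.
have later p w' : (run_pass (f_reset d) (true, false) (mkoff p.+1 w' m)).2 =
    mkoff p.+1 w' (fun i b => if i == d then 0 else m i b).
  elim: w' p => //= c w' IH p; rewrite IH; congr ((_, _) :: _).
  by apply/setP => -[i b]; rewrite !inE /= eqd; case: eqP.
case: w => //= c w; rewrite later; congr ((_, _) :: _).
by apply/setP => -[i b]; rewrite !inE /= eqd; case: eqP.
Qed.

Definition f_incr d b (s : pstate) (g : cell) : pstate * cell :=
  ((mark d b g, false), (g.1, [set t : 'I_K.+1 * bool |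
     if t == (inord d, b) then s.1 else t \in g.2])).

(** The bit carries the pebble to the next cell. On a segment starting at [p] the incoming bit says
    that the pebble stood just before it; at [p = 0] this is [false], and the outgoing bit tells
    whether the pebble has left the tape. *)
Lemma f_incrP d b p w m : d <= K ->
  run_pass (f_incr d b) ((m d b).+1 == p, false) (mkoff p w m) =
  (((m d b).+1 == p + size w, false),
   mkoff p w (fun i b' => if (i == d) && (b' == b) then (m d b).+1 else m i b')).
Proof.
move=> le_d; have eqd (t : 'I_K.+1) b' : ((t, b') == (inord d, b)) = (val t == d) && (b' == b).
  by rewrite -pair_eqE /pair_eq /= -val_eqE /= inordK.
elim: w p => [|c w IH] p /=; first by rewrite addn0.
rewrite markE // -[m d b == p]eqSS IH /= addSnnS; congr (_, (_, _) :: _).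
by apply/setP => -[i b']; rewrite !inE /= eqd; case: ifP.
Qed.

End Marks.

(** * Evaluation of a formula by moving pebbles *)

Section Eval.
Variable K : nat.
Notation sweep := (sweep (cell K)).


(** The four control states of a count are: [(false, false)] reset, [(false, true)] increment the
    counter, [(true, false)] advance the variable, [(true, true)] compare. An answer [b] of the body
    leads to [(~~ b, b)], so a negative one skips the counter. The loop ends when the variable falls
    off the tape. *)
Fixpoint eval (d : nat) (f : fo) : sweep :=
  match f with
  | FoSym c i => @Sweep _ unit tt (fun _ s g => (h_sym c i s g, g)) (fun _ s => inr s.1)
  | FoLt i j => @Sweep _ unit tt (fun _ s g => (h_lt i j s g, g)) (fun _ s => inr s.2)
  | FoNot f =>
      let M := eval d f in
      @Sweep _ (spos M) (sstart M) (@spass _ M) (fun p s =>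
        match snext p s with inl q => inl q | inr b => inr (~~ b) end)
  | FoAnd f1 f2 =>
      let M1 := eval d f1 in let M2 := eval d f2 in
      @Sweep _ (spos M1 + spos M2)%type (inl (sstart M1))
        (fun p => match p with inl p => spass p | inr p => spass p end)
        (fun p s => match p with
           | inl p => match snext p s with
               | inl q => inl (inl q)
               | inr b => if b then inl (inr (sstart M2)) else inr false
               end
           | inr p => match snext p s with inl q => inl (inr q) | inr b => inr b end
           end)
  | FoCount f k =>
      let M := eval d.+1 f in
      @Sweep _ (bool * bool + spos M)%type (inl (false, false))
        (fun p => match p with
           | inl (false, false) => f_reset d
           | inl (false, true) => f_incr d true
           | inl (true, false) => f_incr d false
           | inl (true, true) => fun s g => (h_cnt d k s g, g)
           | inr p => spass p
           end)
        (fun p s => match p with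
           | inl (false, false) => inl (inr (sstart M))
           | inl (false, true) => inl (inl (true, false))
           | inl (true, false) =>
               if s.1 then inl (inl (true, true)) else inl (inr (sstart M))
           | inl (true, true) => inr s.2
           | inr p => match snext p s with
               | inl q => inl (inr q)
               | inr b => inl (inl (~~ b, b))
               end
           end)
  end.

(** Each of the [N] rounds of a count takes at most the body, one counter pass and one advance; the
    outer 2 is the reset and the comparison. *)
Fixpoint cost (N : nat) (f : fo) : nat :=
  match f with
  | FoSym _ _ | FoLt _ _ => 1
  | FoNot f => cost N f
  | FoAnd f g => cost N f + cost N g
  | FoCount f _ => N * (cost N f + 2) + 2
  end.

Definition vars (m : nat -> bool -> nat) : nat -> nat := fun i => m i false.

Variable w : seq (option bool).
Hypothesis w_gt0 : 0 < size w.

(** Pebbles from [d] on may be left anywhere, since a quantifier resets its own before using them;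
    only the outer variables have to survive. *)
Lemma evalP d f m : wf d f -> d + qdepth f <= K.+1 ->
  exists2 m', (forall i b, i < d -> m' i b = m i b) &
    reaches (M := eval d f) (cost (size w) f)
      (inl (sstart (eval d f)), mkoff K 0 w m)
      (inr (sat w d (vars m) f), mkoff K 0 w m').
Proof.
elim: f d m => [c i|i j|f IH|f IHf g IHg|f IH k] d m.
- move=> /= lt_i le_d; exists m => //; exists 1 => //.
  rewrite /= /sstep /= run_pass_test h_symP /=; last by lia.
  by rewrite subn0 add0n.
- move=> /= /andP[lt_i lt_j] le_d; exists m => //; exists 1 => //.
  rewrite /= /sstep /= run_pass_test h_ltP /=; try lia.
  by rewrite add0n andbC.
- move=> /= wff le_d; have [m' em' h] := IH d m wff le_d; exists m' => //.
  exact: (@reaches_embed _ (eval d f) (eval d (FoNot f)) id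
    (fun b => inr (~~ b)) (fun p => erefl) (fun p s => erefl) _ _ _ _ _ h).
- move=> /= /andP[wff wfg] le_d.
  have [||m1 em1 h1] := IHf d m => //; first by lia.
  have [||m2 em2 h2] := IHg d m1 => //; first by lia.
  have {}h1 := @reaches_embed _ _ (eval d (FoAnd f g)) inl
    (fun b => if b then inl (inr (sstart (eval d g))) else inr false)
    (fun p => erefl) (fun p s => erefl) _ _ _ _ _ h1.
  case: (sat w d (vars m) f) h1 => /= h1; last first.
    by exists m1 => //; apply: reaches_leq h1; apply: leq_addr.
  have {}h2 := @reaches_embed _ _ (eval d (FoAnd f g)) inr
    (fun b => inr b) (fun p => erefl) (fun p s => erefl) _ _ _ _ _ h2.
  exists m2; first by move=> i b lt_i; rewrite em2 // em1.
  rewrite (@eq_sat _ _ _ (vars m1)) // => [|i lt_i]; last by rewrite /vars em1.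
  exact: reaches_trans h1 h2.
- move=> /= /andP[wff wfk] le_d; have le_dK : d <= K by lia.
  set N := size w; set M := eval d (FoCount f k).
  set P := fun v => sat w d.+1 (upd (vars m) d v) f.
  set c := cost N f.
  set res := sat w d (vars m) (FoCount f k).
  (* Invariant with [j] rounds to go: the variable stands at [v] and the counter holds the number of
     witnesses below [v]. The body runs before the end test, so [j] is positive, which holds
     initially because the tape is nonempty. *)
  have loop j v m1 : v + j = N -> 0 < j -> m1 d false = v ->
      m1 d true = count P (iota 0 v) -> (forall i b, i < d -> m1 i b = m i b) ->
    exists2 m', (forall i b, i < d -> m' i b = m i b) &
      reaches (M := M) (j * (c + 2) + 1) (inl (inr (sstart (eval d.+1 f))), mkoff K 0 w m1)
        (inr res, mkoff K 0 w m').
    elim: j v m1 => // j IHj v m1 eN _ ev ec em1.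
    have [||m2 em2 h2] := IH d.+1 m1 => //; first by lia.
    have eP : sat w d.+1 (vars m1) f = P v.
      apply: eq_sat => // i; rewrite ltnS leq_eqVlt /upd /vars -[eqn i d]/(i == d).
      by case: eqP => [->|_] //= lt_i; rewrite em1.
    rewrite eP in h2.
    have {}h2 := @reaches_embed _ _ M inr
      (fun b => inl (inl (~~ b, b))) (fun p => erefl) (fun p s => erefl) _ _ _ _ _ h2.
    have [m3 [e3f e3t e3] h3] : exists2 m3, [/\ m3 d false = v,
        m3 d true = count P (iota 0 v.+1) & forall i b, i < d -> m3 i b = m i b] &
        reaches (M := M) 1 (inl (inl (~~ P v, P v)), mkoff K 0 w m2)
          (inl (inl (true, false)), mkoff K 0 w m3).
      rewrite -addn1 iotaD count_cat add0n /= addn0 -ec.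
      have e2 i b : i < d -> m2 i b = m i b.
        by move=> lt_i; rewrite em2 ?em1 // ltnW.
      case: (P v) => /=; last first.
        exists m2; last exact: (reaches_leq (n1 := 0)) (reaches_refl _ _).
        by rewrite addn0 !em2.
      exists (fun i b' => if (i == d) && (b' == true) then (m2 d true).+1 else m2 i b').
        split=> [||i b lt_i].
        - by rewrite andbF em2.
        - by rewrite !eqxx /= em2 // addn1.
        by rewrite /= ltn_eqF //= e2.
      by exists 1; rewrite //= /sstep /= (f_incrP true 0 w m2 le_dK).
    pose m4 i b := if (i == d) && (b == false) then (m3 d false).+1 else m3 i b.
    have e4 i b : i < d -> m4 i b = m i b.
      by move=> lt_i; rewrite /m4 ltn_eqF //= e3.
    have h4 : sstep (M := M) (inl (inl (true, false)), mkoff K 0 w m3) =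
        (if v.+1 == N then inl (inl (true, true)) else inl (inr (sstart (eval d.+1 f))),
         mkoff K 0 w m4).
      by rewrite /sstep /= (f_incrP false 0 w m3 le_dK) /= add0n /m4 e3f.
    have h5 := reaches_trans (reaches_leq (leqnn _) h2) h3.
    case: eqP h4 => [eNv|neN] h4.
      have {IHj eN} -> : j = 0 by lia.
      exists m4 => //; rewrite mul1n.
      have -> : c + 2 + 1 = (c + 1) + 2 by lia.
      apply: reaches_trans h5 _; apply: reaches_step; rewrite h4.
      exists 1 => //=; rewrite /sstep /= run_pass_test h_cntP //; last first.
        by case: (k) wfk => // k' wfk; lia.
      rewrite /res /= add0n /m4 /= andbF e3t eNv -/N; congr (inr _, _).
      case: (k) wfk => [k'|_]; last first.
        by case: (count _ _) => [|n]; rewrite ?andbF ?andbT.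
      by move=> lt_k; rewrite (ltn_eqF lt_k) /= e3 // eq_sym andbC.
    have [|||||m5 e5 h6] := IHj v.+1 m4.
    - by lia.
    - by lia.
    - by rewrite /m4 !eqxx /= e3f.
    - by rewrite /m4 andbF.
    - exact: e4.
    exists m5 => //; rewrite mulSn.
    have -> : c + 2 + j * (c + 2) + 1 = (c + 1) + (j * (c + 2) + 1).+1 by lia.
    apply: reaches_trans h5 _; apply: reaches_step; rewrite h4; exact: h6.
  have [|||||m' em' h] := loop N 0 (fun i b => if i == d then 0 else m i b);
    rewrite /= ?eqxx //.
    by move=> i b lt_i; rewrite (ltn_eqF lt_i).
  exists m' => //; rewrite -[2]/(1 + 1) addnA addn1; apply: reaches_step.
  by rewrite /sstep /= f_resetP.
Qed.

End Eval.

(** * Simulation by a Turing machine *)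

Section Machine.
Variables (G : finType) (inj : option bool -> G) (inj_inj : injective inj).
Variable M : sweep G.

Definition tstate : finType := (bool + spos M * (pstate * bool))%type.

Definition enter (c : spos M + bool) : tstate :=
  match c with inl p => inr (p, ((false, false), false)) | inr b => inl b end.

(* State [inr (p, (s, false))] runs pass [p] rightwards; [inr (p, (s, true))] is the way back to the left end. *)
Definition tdelta (q : tstate) (g : option G) : tstate * option G * dir :=
  match q, g with
  | inl b, _ => (inl b, g, Stay)
  | inr (p, (s, false)), Some g =>
      (inr (p, ((spass p s g).1, false)), Some (spass p s g).2, MoveR)
  | inr (p, (s, false)), None => (inr (p, (s, true)), None, MoveL)
  | inr (p, (s, true)), Some _ => (q, g, MoveL)
  | inr (p, (s, true)), None => (enter (snext p s), None, MoveR)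
  end.

Definition sweep_TM : TM.
Proof.
refine (@Build_TM tstate (option G) None (fun c => Some (inj c)) _ _
          (enter (inl (sstart M))) (inl true) tdelta).
- by move=> c c' [/inj_inj].
- by [].
Defined.

Notation step := (@step sweep_TM).

(** [cfgr] and [cfgl] have the head on the first cell of [r] and of [l] respectively. An empty list
    is read as a blank, so the ends of the tape need no separate case. *)
Definition cfgr (q : tstate) (l r : seq (option G)) : config sweep_TM :=
  @Config sweep_TM q l (head None r) (behead r).
Definition cfgl (q : tstate) (l r : seq (option G)) : config sweep_TM :=
  @Config sweep_TM q (behead l) (head None l) r.

Lemma step_forward p s l T r :
  iter (size T) step (cfgr (inr (p, (s, false))) l (map some T ++ r)) =
  cfgr (inr (p, ((run_pass (spass p) s T).1, false)))
       (catrev (map some (run_pass (spass p) s T).2) l) r.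
Proof.
elim: T s l => // g T IH s l; rewrite [size _]/= iterSr.
have -> : step (cfgr (inr (p, (s, false))) l (map some (g :: T) ++ r)) =
    cfgr (inr (p, ((spass p s g).1, false))) (Some (spass p s g).2 :: l) (map some T ++ r).
  by [].
by rewrite IH.
Qed.

Lemma step_back p s l T r :
  iter (size T) step (cfgl (inr (p, (s, true))) (map some T ++ l) r) =
  cfgl (inr (p, (s, true))) l (catrev (map some T) r).
Proof.
elim: T r => // g T IH r; rewrite [size _]/= iterSr.
have -> : step (cfgl (inr (p, (s, true))) (map some (g :: T) ++ l) r) =
    cfgl (inr (p, (s, true))) (map some T ++ l) (Some g :: r) by [].
by rewrite IH.
Qed.

(** Turning round on a blank stores that blank explicitly in the configuration; [a] and [b] absorb
    these blanks on the two sides. *)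
Definition home (c : (spos M + bool) * seq G) (a b : nat) : config sweep_TM :=
  cfgr (enter c.1) (nseq a None) (map some c.2 ++ nseq b None).

(** One pass costs [size T] moves in each direction and one turn at each end. *)
Lemma step_home p T a b : exists a' b',
  iter (2 * size T + 2) step (home (inl p, T) a b) = home (sstep (inl p, T)) a' b'.
Proof.
exists a.-1.+1, b.-1.+1.
have -> : 2 * size T + 2 = (size T).+1 + (size T).+1 by lia.
rewrite iterD [X in iter _ _ X]iterS step_forward.
set r := run_pass _ _ _.
have -> : step (cfgr (inr (p, (r.1, false))) (catrev (map some r.2) (nseq a None))
    (nseq b None)) = cfgl (inr (p, (r.1, true)))
      (map some (rev r.2) ++ nseq a None) (None :: nseq b.-1 None).
  by rewrite map_rev -catrevE; case: b.
have -> : size T = size (rev r.2) by rewrite size_rev size_run_pass.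
rewrite iterS step_back.
have -> : catrev (map some (rev r.2)) (None :: nseq b.-1 None) =
    map some r.2 ++ nseq b.-1.+1 None.
  by rewrite catrevE -map_rev revK.
by case: a.
Qed.

(** Only [qacc] freezes a machine, so rejection means looping in [inl false]. *)
Lemma step_reject n (c : config sweep_TM) :
  cstate c = inl false :> tstate -> cstate (iter n step c) = inl false :> tstate.
Proof. by elim: n => //= n IH /IH; case: (iter n _ _) => q l h r /= ->. Qed.

Lemma step_accept n (c : config sweep_TM) :
  cstate c = inl true :> tstate -> iter n step c = c.
Proof. by move=> e; elim: n => //= n ->; case: c e => q l h r /= ->. Qed.

Lemma sim_home n c a b : exists t a' b',
  t <= n * (2 * size c.2 + 2) /\
  iter t step (home c a b) = home (iter n (@sstep _ M) c) a' b'.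
Proof.
elim: n c a b => [|n IH] [[p|v] T] a b.
- by exists 0, a, b.
- by exists 0, a, b.
- have [a1 [b1 e1]] := step_home p T a b.
  have [t [a2 [b2 [le_t e2]]]] := IH (sstep (inl p, T)) a1 b1.
  exists (t + (2 * size T + 2)), a2, b2; rewrite iterD e1 e2 iterSr; split=> //.
  by move: le_t; rewrite /sstep /= size_run_pass mulSn; lia.
- by exists 0, a, b; rewrite iter_sstep_exit.
Qed.

(** Both exit states are permanent. Hence acceptance at any time reveals the answer, with no bound
    on [t], while the bound in the second half is the number of passes times the cost of one. *)
Lemma sweep_TM_accepts n b T x :
  reaches n (inl (sstart M), map inj x) (inr b, T) ->
  (forall t, accepts_within sweep_TM x t -> b) /\
  (b -> forall t, n * (2 * size x + 2) <= t -> accepts_within sweep_TM x t).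
Proof.
case=> k le_k ek.
have [t [a' [b' []]]] := sim_home k (inl (sstart M), map inj x) 0 0.
rewrite ek /= size_map => le_t.
have -> : home (inl (sstart M), map inj x) 0 0 = init sweep_TM x.
  by rewrite /home cats0 /= /init /cfgr /= -map_comp.
move=> et; rewrite /accepts_within; split=> [u|eb u le_u].
  case: b ek et => // _ et /eqP eu.
  case: (leqP u t) => [le_ut|/ltnW le_tu].
    by move: et; rewrite -(subnK le_ut) iterD step_accept // => e; move: eu; rewrite e.
  move: eu; rewrite -(subnK le_tu) iterD et step_reject //.
have le_tu : t <= u by apply: leq_trans le_u; apply: leq_trans le_t _; rewrite leq_mul2r le_k orbT.
by rewrite -(subnK le_tu) iterD et eb step_accept.
Qed.

End Machine.

(** * Polynomial bounds *)

Definition polyb (f : nat -> nat) := exists c k, forall n, f n <= c * n ^ k + c.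

Lemma leq_expn2r m n k : m <= n -> m ^ k <= n ^ k.
Proof. by case: k => // k le_mn; rewrite leq_exp2r. Qed.

(** Without an additive constant, and with a base that is never 0, bounds multiply and compose
    directly. *)
Lemma polybE f : polyb f <-> exists c k, forall n, f n <= c * n.+1 ^ k.
Proof.
split=> -[c [k h]].
  exists (c + c), k => n; apply: leq_trans (h n) _; rewrite mulnDl leq_add //.
    by rewrite leq_mul2l leq_expn2r ?orbT.
  by rewrite leq_pmulr // expn_gt0.
(* For [n > 0], [n.+1 <= 2 * n] costs a factor [2 ^ k]; the value at 0 is covered by the additive
   constant. *)
exists (c * 2 ^ k), k => n; apply: leq_trans (h n) _.
case: n => [|n].
  by rewrite exp1n muln1; apply: leq_trans (leq_addl _ _); rewrite leq_pmulr ?expn_gt0.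
apply: leq_trans (leq_addr _ _); rewrite -mulnA leq_mul2l -expnMn; apply/orP; right.
by apply: leq_expn2r; lia.
Qed.

Lemma polyb_leq f g : (forall n, f n <= g n) -> polyb g -> polyb f.
Proof. by move=> le_fg [c [k h]]; exists c, k => n; apply: leq_trans (h n). Qed.

Lemma polyb_const c : polyb (fun => c).
Proof. by exists c, 0 => n; apply: leq_addl. Qed.

Lemma polyb_id : polyb id.
Proof. by exists 1, 1 => n; rewrite mul1n expn1 leq_addr. Qed.

Lemma polybD f g : polyb f -> polyb g -> polyb (fun n => f n + g n).
Proof.
move=> /polybE[c1 [k1 h1]] /polybE[c2 [k2 h2]].
apply/polybE; exists (c1 + c2), (k1 + k2) => n.
rewrite mulnDl leq_add //.
  by apply: leq_trans (h1 n) _; rewrite leq_mul2l expnD leq_pmulr ?orbT ?expn_gt0.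
by apply: leq_trans (h2 n) _; rewrite leq_mul2l expnD leq_pmull ?orbT ?expn_gt0.
Qed.

Lemma polybM f g : polyb f -> polyb g -> polyb (fun n => f n * g n).
Proof.
move=> /polybE[c1 [k1 h1]] /polybE[c2 [k2 h2]].
apply/polybE; exists (c1 * c2), (k1 + k2) => n.
by rewrite expnD mulnACA leq_mul.
Qed.

Lemma polyb_comp f g : polyb f -> polyb g -> polyb (fun n => f (g n)).
Proof.
move=> /polybE[c1 [k1 h1]] /polybE[c2 [k2 h2]].
apply/polybE; exists (c1 * c2.+1 ^ k1), (k2 * k1) => n.
apply: leq_trans (h1 _) _; rewrite -mulnA leq_mul2l expnM -expnMn; apply/orP; right.
apply: leq_expn2r; rewrite mulSn -addn1 addnC leq_add // expn_gt0 //.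
Qed.

Lemma leq_cost m n f : m <= n -> cost m f <= cost n f.
Proof.
move=> le_mn; elim: f => //= [f IHf g IHg|f IH _]; first exact: leq_add.
by rewrite leq_add2r leq_mul // leq_add2r.
Qed.

Lemma polyb_cost f : polyb (fun n => cost n f).
Proof.
elim: f => [c i|i j|f IH|f IHf g IHg|f IH k] /=.
- exact: polyb_const.
- exact: polyb_const.
- exact: IH.
- exact: polybD.
- apply: polybD (polyb_const _); apply: polybM polyb_id _.
  exact: polybD IH (polyb_const _).
Qed.

(** * From formulas to NP *)

Definition tape_word (x y : seq bool) : seq (option bool) :=
  map some x ++ None :: map some y.

Lemma size_tape_word x y : size (tape_word x y) = size x + (size y).+1.
Proof. by rewrite size_cat /= !size_map. Qed.

(* Polynomially bounded certificates checked by a first-order formula with counting: a substitute for Fagin's theorem. *)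
Lemma fo_in_NP (L : seq bool -> Prop) (f : fo) (p : nat -> nat) :
  wf 0 f -> polyb p ->
  (forall x, L x -> exists2 y, size y <= p (size x) & sat (tape_word x y) 0 id f) ->
  (forall x y, sat (tape_word x y) 0 id f -> L x) ->
  in_NP L.
Proof.
move=> wff pp complete sound.
set K := qdepth f.
pose inj (c : option bool) : cell K := (c, set0).
have inj_inj : injective inj by move=> c c' [].
(* An unmarked tape is one with all pebbles off the tape, so the input needs no preparation. *)
have unmarked n w q : q + size w <= n -> map inj w = mkoff K q w (fun _ _ => n).
  elim: w q => //= c w IH q le_n; rewrite (IH q.+1); last by rewrite addSnnS.
  by congr ((_, _) :: _); apply/setP => t; rewrite !inE; lia.
have run x y : exists T, reaches (M := eval K 0 f) (cost (size (tape_word x y)) f)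
    (inl (sstart (eval K 0 f)), map inj (tape_word x y))
    (inr (sat (tape_word x y) 0 id f), T).
  set w := tape_word x y; pose m (i : nat) (b : bool) := size w.
  have w_gt0 : 0 < size w by rewrite size_tape_word addnS.
  have [|m' _ h] := @evalP K w w_gt0 0 f m wff; first by [].
  exists (mkoff K 0 w m'); rewrite (@eq_sat _ _ _ (vars m)) //.
  by rewrite (unmarked (size w) w 0).
pose B n := let N := n + (p n).+1 in cost N f * (2 * N + 2).
have pB : polyb B.
  have pN : polyb (fun n => n + (p n).+1).
    apply: polybD polyb_id _; apply: (polyb_leq (g := fun n => 1 + p n)) => //.
    exact: polybD (polyb_const _) pp.
  apply: polybM; first exact: polyb_comp (polyb_cost f) pN.
  by apply: polybD (polyb_const _); apply: polybM (polyb_const _) pN.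
(* [in_NP] uses one pair of constants for certificate length and time; bounding the sum provides
   it. *)
have [c [k ck]] := polybD pp pB.
exists (sweep_TM inj_inj (eval K 0 f)), c, k => x; split.
  move=> /complete[y le_y sat_y]; exists y.
  have le_p : p (size x) <= c * size x ^ k + c := leq_trans (leq_addr _ _) (ck _).
  split; first exact: leq_trans le_p.
  have [T /(sweep_TM_accepts inj_inj) [_ /(_ sat_y)]] := run x y; apply.
  apply: leq_trans (ck _); apply: leq_trans (leq_addl _ _).
  have le_N : size (tape_word x y) <= size x + (p (size x)).+1.
    by rewrite size_tape_word leq_add2l.
  by rewrite /B leq_mul ?leq_cost // leq_add2r leq_mul2l.
case=> y [_ acc]; apply: (sound x y).
by have [T /(sweep_TM_accepts inj_inj) [/(_ _ acc)]] := run x y.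
Qed.

(** * Unary fields of the tape *)

Definition FoEx f := FoNot (FoCount f None).
Definition FoEq i j := FoAnd (FoNot (FoLt i j)) (FoNot (FoLt j i)).

Lemma satEx w d rho f :
  sat w d rho (FoEx f) <-> exists2 v, v < size w & sat w d.+1 (upd rho d v) f.
Proof.
rewrite /= -lt0n -has_count; split=> [/hasP[v]|[v lt_v h]].
  by rewrite mem_iota add0n => /andP[_ lt_v] h; exists v.
by apply/hasP; exists v; rewrite // mem_iota.
Qed.

Lemma satAnd w d rho f g :
  sat w d rho (FoAnd f g) = sat w d rho f && sat w d rho g.
Proof. by []. Qed.

Lemma satNot w d rho f : sat w d rho (FoNot f) = ~~ sat w d rho f.
Proof. by []. Qed.

Lemma upd_same rho d v : upd rho d v d = v.
Proof. by rewrite /upd -[eqn d d]/(d == d) eqxx. Qed.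

Lemma upd_lt rho d v i : i < d -> upd rho d v i = rho i.
Proof. by move=> lt_i; rewrite /upd -[eqn i d]/(i == d) (ltn_eqF lt_i). Qed.

Lemma upd_S rho d v : upd rho d.+1 v d = rho d.
Proof. exact: upd_lt. Qed.

Lemma upd_SS rho d v : upd rho d.+2 v d = rho d.
Proof. by rewrite upd_lt. Qed.

Definition updE := (upd_same, upd_S, upd_SS).

Lemma count_iota_lt (Q : pred nat) p n : p <= n ->
  count (fun q => (q < p) && Q q) (iota 0 n) = count Q (iota 0 p).
Proof.
move=> le_pn; rewrite -(subnKC le_pn) iotaD count_cat addnC.
rewrite (@eq_in_count _ _ pred0 (iota (0 + p) _)) ?count_pred0 => [|q]; last first.
  by rewrite mem_iota => /andP[le_p _]; rewrite ltnNge le_p.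
by apply: eq_in_count => q; rewrite mem_iota => /andP[_ ->].
Qed.

Lemma count_prefix (T : Type) (x0 : T) (P : pred T) (w : seq T) p : p <= size w ->
  count (fun q => (q < p) && P (nth x0 w q)) (iota 0 (size w)) = count P (take p w).
Proof.
move=> le_p; rewrite (@count_iota_lt (fun q => P (nth x0 w q))) //.
by rewrite -(map_nth_iota0 x0 le_p) count_map.
Qed.

(* The blocks of ones closed by a zero, [acc] ones having been read before; separators are skipped. *)
Fixpoint fields (acc : nat) (w : seq (option bool)) : seq nat :=
  match w with
  | [::] => [::]
  | Some true :: w => fields acc.+1 w
  | Some false :: w => acc :: fields 0 w
  | None :: w => fields acc w
  end.

Fixpoint pending (acc : nat) (w : seq (option bool)) : nat :=
  match w with
  | [::] => acc
  | Some true :: w => pending acc.+1 w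
  | Some false :: w => pending 0 w
  | None :: w => pending acc w
  end.

Lemma pending_rcons acc w c :
  pending acc (rcons w c) = match c with
    | Some true => (pending acc w).+1 | Some false => 0 | None => pending acc w end.
Proof. by elim: w acc => [|[[]|] w IH] acc //=; case: c {IH} => // -[]. Qed.

(** A field is located by the zero that closes it: the number of earlier zeros is its index, the
    ones pending there are its value. Both are counts, as [fo_get] requires. *)
Lemma onth_fields acc w f v : onth (fields acc w) f = Some v <->
  exists p, [/\ p < size w, nth None w p = Some false,
    count_mem (Some false) (take p w) = f & pending acc (take p w) = v].
Proof.
elim: w acc f => [|c w IH] acc f; first by case: f => [|f]; split=> // -[p []].
rewrite /=.
case: c => [[]|].
- rewrite IH; split=> [[p [? ? ? ?]]|[[|p] [lt_p //= e1 e2 e3]]].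
    by exists p.+1.
  by exists p.
- case: f => [|f] /=.
    split=> [[<-]|[[|p] [lt_p e1 e2 e3]]] //=; first by exists 0.
    by move: e3 => /= <-.
  rewrite IH; split=> [[p [? ? e ?]]|[[|p] [lt_p //= e1 [e2] e3]]].
    by exists p.+1; rewrite /= e.
  by exists p.
- rewrite IH; split=> [[p [? ? ? ?]]|[[|p] [lt_p //= e1 e2 e3]]].
    by exists p.+1.
  by exists p.
Qed.

(** A one at [q] that still counts at [p], no zero having closed its block; this is the first-order
    reading of [pending]. *)
Definition open_one (w : seq (option bool)) (p q : nat) : bool :=
  (nth None w q == Some true) &&
  ~~ has (fun r => [&& q < r, r < p & nth None w r == Some false]) (iota 0 (size w)).

Lemma count_open w p : p <= size w ->
  count (open_one w p) (iota 0 p) = pending 0 (take p w).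
Proof.
elim: p => [|p IH] lt_p; first by rewrite take0.
rewrite (take_nth None) // pending_rcons -addn1 iotaD count_cat /= addn0.
have hz q : q < p -> has (fun r => [&& q < r, r < p + 1 & nth None w r == Some false])
      (iota 0 (size w)) =
    has (fun r => [&& q < r, r < p & nth None w r == Some false])
      (iota 0 (size w)) || (nth None w p == Some false).
  move=> lt_q; apply/hasP/orP => [[r]|[/hasP[r ir /and3P[h1 h2 h3]]|h]].
  - rewrite mem_iota => ir /and3P[h1 h2 h3]; move: h2; rewrite addn1 ltnS leq_eqVlt.
    case/orP=> [/eqP <-|h2]; [by right | left].
    by apply/hasP; exists r; rewrite ?mem_iota // h1 h2.
  - by exists r; rewrite // h1 h3 ltn_addr.
  by exists p; rewrite ?mem_iota //= lt_q h addn1 ltnSn.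
case ep: (nth None w p) => [[]|].
- rewrite -IH ?(ltnW lt_p) // -[RHS]addn1; congr (_ + _).
    apply: eq_in_count => q; rewrite mem_iota => /andP[_ lt_q].
    by rewrite /open_one hz // ep orbF.
  rewrite /open_one ep /=; case: hasP => // -[r _] /and3P[]; lia.
- rewrite /open_one ep andFb addn0 (@eq_in_count _ _ pred0) ?count_pred0 // => q.
  by rewrite mem_iota => /andP[_ lt_q]; rewrite hz // ep orbT andbF.
- rewrite -IH ?(ltnW lt_p) // /open_one ep andFb addn0.
  apply: eq_in_count => q; rewrite mem_iota => /andP[_ lt_q].
  by rewrite hz // ep orbF.
Qed.

Definition fo_zeros d p k :=
  FoCount (FoAnd (FoLt d p) (FoSym (Some false) d)) (Some k).

(** Variable [d] is the closing zero of the field, [d.+1] runs over the ones of its block, and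
    [d.+2] looks for a zero between the two. *)
Definition fo_get d f v :=
  FoEx (FoAnd (FoSym (Some false) d) (FoAnd (fo_zeros d.+1 d f)
    (FoCount (FoAnd (FoLt d.+1 d) (FoAnd (FoSym (Some true) d.+1)
       (FoNot (FoEx (FoAnd (FoLt d.+1 d.+2) (FoAnd (FoLt d.+2 d)
          (FoSym (Some false) d.+2))))))) (Some v)))).

Lemma sat_zeros w d rho p k : p < d -> k < d -> rho p < size w -> rho k < size w ->
  sat w d rho (fo_zeros d p k) = (count_mem (Some false) (take (rho p) w) == rho k).
Proof.
move=> lt_p lt_k lt_pN lt_kN /=.
rewrite -(@count_prefix _ None _ w) ?(ltnW lt_pN) //.
set n := count _ _; set n' := count _ _.
have -> : n = n'.
  apply: eq_in_count => q; rewrite mem_iota add0n => /andP[_ lt_q].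
  by rewrite upd_same upd_lt // lt_pN lt_q andbT.
by case: eqP => //= ->.
Qed.

Lemma sat_get w d rho f v : f < d -> v < d -> rho f < size w -> rho v < size w ->
  sat w d rho (fo_get d f v) <-> onth (fields 0 w) (rho f) = Some (rho v).
Proof.
move=> lt_f lt_v lt_fN lt_vN; rewrite onth_fields satEx.
have key p : p < size w -> sat w d.+1 (upd rho d p)
    (FoAnd (FoSym (Some false) d) (FoAnd (fo_zeros d.+1 d f)
    (FoCount (FoAnd (FoLt d.+1 d) (FoAnd (FoSym (Some true) d.+1)
       (FoNot (FoEx (FoAnd (FoLt d.+1 d.+2) (FoAnd (FoLt d.+2 d)
          (FoSym (Some false) d.+2))))))) (Some v)))) =
    [&& nth None w p == Some false, count_mem (Some false) (take p w) == rho f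
      & pending 0 (take p w) == rho v].
  move=> lt_p; rewrite 2!satAnd sat_zeros ?upd_same ?(upd_lt _ _ lt_f) //;
    last exact: ltnW.
  rewrite [X in X && _]/= upd_same lt_p /=; congr [&& _, _ & _].
  rewrite -count_open ?(ltnW lt_p) // -(@count_iota_lt (open_one w p) p (size w)) ?(ltnW lt_p) //.
  set n := count _ _; set n' := count _ _.
  have -> : n = n'.
    apply: eq_in_count => q; rewrite mem_iota add0n => /andP[_ lt_q].
    rewrite !updE lt_p lt_q andbT /=; congr (_ && _).
    rewrite /open_one negbK; congr (_ && _); rewrite -[LHS]negbK -lt0n -has_count.
    congr (~~ _); apply: eq_in_has => r; rewrite mem_iota add0n => /andP[_ lt_r].
    by rewrite !updE lt_r lt_p !andbT.
  by rewrite (upd_lt _ _ lt_v); case: eqP => //= ->.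
split=> [[p lt_p]|[p [lt_p e1 e2 e3]]].
  by rewrite key // => /and3P[/eqP e1 /eqP e2 /eqP e3]; exists p.
by exists p => //; rewrite key // e1 e2 e3 !eqxx.
Qed.

Section SmallFormulas.
Variables (w : seq (option bool)) (d : nat) (rho : nat -> nat).

Lemma sat_lt i j : rho j < size w -> sat w d rho (FoLt i j) = (rho i < rho j).
Proof. by move=> /= ->; rewrite andbT. Qed.

Lemma sat_eq i j : rho i < size w -> rho j < size w ->
  sat w d rho (FoEq i j) = (rho i == rho j).
Proof. by move=> /= -> ->; rewrite !andbT -!leqNgt andbC -eqn_leq. Qed.

Definition fo_zero v := FoNot (FoEx (FoLt d v)).

Lemma sat_zero v : v < d -> rho v < size w -> sat w d rho (fo_zero v) <-> rho v = 0.
Proof.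
move=> lt_v lt_vN; rewrite satNot; split=> [/negP h|e].
  case e: (rho v) => [|n] //; case: h; apply/satEx; exists 0; first by rewrite (leq_trans _ lt_vN).
  by rewrite /= updE (upd_lt _ _ lt_v) lt_vN e.
by apply/negP => /satEx[u _ /=]; rewrite updE (upd_lt _ _ lt_v) e.
Qed.

Definition fo_succ u v := FoAnd (FoLt u v) (FoNot (FoEx (FoAnd (FoLt u d) (FoLt d v)))).

Lemma sat_succ u v : u < d -> v < d -> rho v < size w ->
  sat w d rho (fo_succ u v) <-> rho v = (rho u).+1.
Proof.
move=> lt_u lt_v lt_vN; rewrite satAnd satNot sat_lt //; split=> [/andP[lt_uv /negP h]|e].
  apply/eqP; rewrite eqn_leq lt_uv andbT leqNgt; apply/negP => lt; case: h.
  apply/satEx; exists (rho u).+1; first exact: ltn_trans lt_vN.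
  by rewrite /= updE !upd_lt // lt_vN lt ltnSn (ltn_trans lt lt_vN).
rewrite e ltnSn; apply/negP => /satEx[q _ /=]; rewrite updE !upd_lt // e; lia.
Qed.

(** The interval from [a] to [v], with [v] excluded, has [b] positions; the first conjunct rules out
    a truncated difference. *)
Definition fo_add a b v :=
  FoAnd (FoNot (FoLt v a)) (FoCount (FoAnd (FoNot (FoLt d a)) (FoLt d v)) (Some b)).

Lemma sat_add a b v : a < d -> b < d -> v < d ->
    rho a < size w -> rho b < size w -> rho v < size w ->
  sat w d rho (fo_add a b v) <-> rho a + rho b = rho v.
Proof.
move=> lt_a lt_b lt_v lt_aN lt_bN lt_vN; rewrite satAnd [X in X && _]/= lt_aN andbT -leqNgt.
rewrite [sat _ _ _ _]/=; set n := count _ _.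
have -> : n = rho v - rho a.
  rewrite /n (@eq_in_count _ _ (fun q => (q < rho v) && (rho a <= q))) => [|q]; last first.
    rewrite mem_iota add0n => /andP[_ lt_q].
    by rewrite updE !upd_lt // lt_aN lt_vN !andbT -leqNgt andbC.
  rewrite count_iota_lt ?(ltnW lt_vN) //; elim: (rho v) => // k IH.
  by rewrite -addn1 iotaD count_cat IH /= addn0; lia.
split; last by move=> <-; rewrite leq_addr addKn eqxx /=.
by case/and3P=> le_av /eqP <- _; rewrite subnKC.
Qed.

End SmallFormulas.

(** * Terms and formulas over the fields *)

Inductive term :=
| TV (i : nat)
| T0
| TS (t : term)
| TAdd (t u : term)
| TGet (t : term)
| TBase.

Fixpoint twf (d : nat) (t : term) : bool :=
  match t with
  | TV i => i < d
  | T0 | TBase => true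
  | TS t | TGet t => twf d t
  | TAdd t u => twf d t && twf d u
  end.

Lemma twf_leq d d' t : d <= d' -> twf d t -> twf d' t.
Proof.
move=> le_d; elim: t => //= [i|t IHt u IHu]; first by move/leq_trans; apply.
by case/andP=> /IHt -> /IHu ->.
Qed.

(* [b] is the number of fields of the input, i.e. the index of the first field of the certificate. *)
Fixpoint tev (W : seq nat) (b : nat) (rho : nat -> nat) (t : term) : option nat :=
  match t with
  | TV i => Some (rho i)
  | T0 => Some 0
  | TS t => if tev W b rho t is Some u then Some u.+1 else None
  | TAdd t u =>
      if tev W b rho t is Some a then
        if tev W b rho u is Some c then Some (a + c) else None
      else None
  | TGet t => if tev W b rho t is Some a then onth W a else None
  | TBase => Some b
  end.

Lemma eq_tev W b rho rho' d t : twf d t -> (forall i, i < d -> rho i = rho' i) ->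
  tev W b rho t = tev W b rho' t.
Proof.
elim: t => //= [i|t IH|t IHt u IHu|t IH].
- by move=> lt_i ->.
- by move=> wft e; rewrite IH.
- by case/andP=> wft wfu e; rewrite IHt // IHu.
- by move=> wft e; rewrite IH.
Qed.

Lemma tev_upd W b rho d v t : twf d t -> tev W b (upd rho d v) t = tev W b rho t.
Proof. by move=> wft; apply: (eq_tev _ _ wft) => i; apply: upd_lt. Qed.

Fixpoint fo_term (d : nat) (t : term) (v : nat) : fo :=
  match t with
  | TV i => FoEq i v
  | T0 => fo_zero d v
  | TS t => FoEx (FoAnd (fo_term d.+1 t d) (fo_succ d.+1 d v))
  | TAdd t u => FoEx (FoEx (FoAnd (fo_term d.+2 t d)
                  (FoAnd (fo_term d.+2 u d.+1) (fo_add d.+2 d d.+1 v))))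
  | TGet t => FoEx (FoAnd (fo_term d.+1 t d) (fo_get d.+1 d v))
  | TBase => FoEx (FoAnd (FoSym None d) (fo_zeros d.+1 d v))
  end.

Definition zeros (x : seq bool) : nat := count_mem false x.

Section Terms.
Variables x y : seq bool.
Notation w := (tape_word x y).
Notation N := (size w).
Notation W := (fields 0 w).

Lemma nth_sep p : (p < N) && (nth None w p == None) = (p == size x).
Proof.
rewrite nth_cat size_map size_tape_word.
case: (ltngtP p (size x)) => [lt|lt|->] /=.
- by rewrite (nth_map false) //= andbF.
- case: p lt => // p; rewrite ltnS => le; rewrite subSn //= addnS ltnS.
  case: ltnP => //= h; rewrite (nth_map false) //; lia.
- by rewrite subnn /= addnS ltnS leq_addr.
Qed.

Lemma onth_fields_lt w' f v : onth (fields 0 w') f = Some v -> f < size w' /\ v < size w'.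
Proof.
case/onth_fields=> p [lt_p _ <- <-]; split; apply: leq_ltn_trans lt_p.
  by apply: leq_trans (count_size _ _) _; rewrite size_take_min geq_minl.
apply: leq_trans (_ : size (take p w') <= _); last by rewrite size_take_min geq_minl.
move: (take p w'); apply: last_ind => // s c IH; rewrite pending_rcons size_rcons.
by case: c => [[]|] //; apply: leqW.
Qed.

(** Intermediate values may be quantified over positions: if a successor or a sum lies on the tape,
    so do its arguments, and field indices and values are always below the tape length. *)
Lemma sat_term d rho t v : (forall i, i < d -> rho i < N) -> twf d t -> v < d ->
  sat w d rho (fo_term d t v) <-> tev W (zeros x) rho t = Some (rho v).
Proof.
have ext d' rho' u : (forall i, i < d' -> rho' i < N) -> u < N ->
    (forall i, i < d'.+1 -> upd rho' d' u i < N).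
  move=> h lt_u i; rewrite ltnS leq_eqVlt => /orP[/eqP ->|lt_i].
    by rewrite updE.
  by rewrite upd_lt // h.
elim: t d rho v => [i||t IH|t IHt u IHu|t IH|] d rho v lt_rho wft lt_v;
  rewrite [fo_term _ _ _]/= [tev _ _ _ _]/=; rewrite /= in wft.
- by rewrite sat_eq ?lt_rho //; split=> [/eqP ->|[->]].
- by rewrite sat_zero ?lt_rho //; split=> [->|[]].
- have key u : u < N ->
      sat w d.+1 (upd rho d u) (fo_term d.+1 t d) <-> tev W (zeros x) rho t = Some u.
    move=> lt_u; rewrite IH ?updE ?tev_upd //; first exact: ext.
    exact: twf_leq wft.
  have succ u : u < N ->
      sat w d.+1 (upd rho d u) (fo_succ d.+1 d v) <-> rho v = u.+1.
    by move=> lt_u; rewrite sat_succ ?updE ?(upd_lt _ _ lt_v) ?lt_rho // ltnW.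
  rewrite satEx; split=> [[u lt_u]|].
    by rewrite satAnd => /andP[/key -> // /succ ->].
  case et: (tev _ _ _ _) => [u|] // [eu].
  have lt_u : u < N by rewrite (ltn_trans (ltnSn u)) // eu lt_rho.
  by exists u => //; rewrite satAnd; apply/andP; split; [apply/key | apply/succ].
- case/andP: wft => wft wfu.
  have keyt a c : a < N -> c < N ->
      sat w d.+2 (upd (upd rho d a) d.+1 c) (fo_term d.+2 t d)
      <-> tev W (zeros x) rho t = Some a.
    move=> lt_a lt_c; have hr := ext _ _ _ (ext _ _ _ lt_rho lt_a) lt_c.
    have wf1 := twf_leq (leqnSn d) wft; have wf2 := twf_leq (leqnSn _) wf1.
    by rewrite IHt ?updE ?tev_upd.
  have keyu a c : a < N -> c < N ->
      sat w d.+2 (upd (upd rho d a) d.+1 c) (fo_term d.+2 u d.+1)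
      <-> tev W (zeros x) rho u = Some c.
    move=> lt_a lt_c; have hr := ext _ _ _ (ext _ _ _ lt_rho lt_a) lt_c.
    have wf1 := twf_leq (leqnSn d) wfu; have wf2 := twf_leq (leqnSn _) wf1.
    by rewrite IHu ?updE ?tev_upd.
  have add a c : a < N -> c < N ->
      sat w d.+2 (upd (upd rho d a) d.+1 c) (fo_add d.+2 d d.+1 v) <-> a + c = rho v.
    move=> lt_a lt_c; have lt_v' : v < d.+1 := leqW lt_v.
    have lt_v'' : v < d.+2 := leqW lt_v'; have lt_d : d < d.+2 := leqnSn d.+1.
    by rewrite sat_add ?updE ?(upd_lt _ _ lt_v') ?(upd_lt _ _ lt_v) ?lt_rho.
  rewrite satEx; split=> [[a lt_a /satEx[c lt_c]]|].
    by rewrite !satAnd => /and3P[/keyt -> // /keyu -> // /add ->].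
  case et: (tev _ _ _ t) => [a|] //; case eu: (tev _ _ _ u) => [c|] // [e].
  have lt_vN := lt_rho v lt_v.
  have lt_a : a < N by lia.
  have lt_c : c < N by lia.
  exists a => //; apply/satEx; exists c => //; rewrite !satAnd.
  by apply/and3P; split; [apply/keyt | apply/keyu | apply/add].
- have key u : u < N ->
      sat w d.+1 (upd rho d u) (fo_term d.+1 t d) <-> tev W (zeros x) rho t = Some u.
    move=> lt_u; rewrite IH ?updE ?tev_upd //; first exact: ext.
    exact: twf_leq wft.
  have get u : u < N ->
      sat w d.+1 (upd rho d u) (fo_get d.+1 d v) <-> onth W u = Some (rho v).
    by move=> lt_u; rewrite sat_get ?updE ?(upd_lt _ _ lt_v) ?lt_rho // ltnW.
  rewrite satEx; split=> [[u lt_u]|].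
    by rewrite satAnd => /andP[/key -> // /get ->].
  case et: (tev _ _ _ _) => [u|] // eu; have [lt_u _] := onth_fields_lt eu.
  by exists u => //; rewrite satAnd; apply/andP; split; [apply/key | apply/get].
- have base p : p < N -> sat w d.+1 (upd rho d p) (FoAnd (FoSym None d) (fo_zeros d.+1 d v))
      = (p == size x) && (zeros x == rho v).
    move=> lt_p; rewrite satAnd sat_zeros ?updE ?(upd_lt _ _ lt_v) ?lt_rho //; last exact: ltnW.
    rewrite [X in X && _]/= updE nth_sep; case: eqP => // ->.
    rewrite take_size_cat ?size_map // count_map /=.
    by rewrite (@eq_count _ _ (pred1 false)) // => -[].
  rewrite satEx; split=> [[p lt_p]|[e]]; first by rewrite base // => /andP[_ /eqP ->].
  have lt_x : size x < N by rewrite size_tape_word addnS ltnS leq_addr.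
  by exists (size x) => //; rewrite base // e !eqxx.
Qed.
End Terms.

(** [fields] skips the separator, so the ones at the end of an input would merge with the first
    block of the certificate. Demanding a zero just before the separator keeps the two apart. *)
Definition fo_last : fo :=
  FoEx (FoAnd (FoSym None 0) (FoEx (FoAnd (FoSym (Some false) 1) (fo_succ 2 1 0)))).

(** A total version of [tev]. Splitting definedness off into [tdef] lets the meaning of formulas be
    stated in plain arithmetic. *)
Fixpoint ev (W : seq nat) (b : nat) (rho : nat -> nat) (t : term) : nat :=
  match t with
  | TV i => rho i
  | T0 => 0
  | TS t => (ev W b rho t).+1
  | TAdd t u => ev W b rho t + ev W b rho u
  | TGet t => nth 0 W (ev W b rho t)
  | TBase => b
  end.

Fixpoint tdef (W : seq nat) (b : nat) (rho : nat -> nat) (t : term) : bool :=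
  match t with
  | TV _ | T0 | TBase => true
  | TS t => tdef W b rho t
  | TAdd t u => tdef W b rho t && tdef W b rho u
  | TGet t => tdef W b rho t && (ev W b rho t < size W)
  end.

Lemma onth_size (s : seq nat) i : onth s i = if i < size s then Some (nth 0 s i) else None.
Proof. by elim: s i => [|a s IH] [|i] //=; rewrite IH ltnS. Qed.

Lemma tevE W b rho t :
  tev W b rho t = if tdef W b rho t then Some (ev W b rho t) else None.
Proof.
elim: t => //= [t ->|t -> u ->|t ->]; try by case: ifP.
  by case: (tdef _ _ _ t); case: (tdef _ _ _ u).
by case: ifP => //= _; apply: onth_size.
Qed.

Inductive rf :=
| REq (t u : term)
| RLt (t u : term)
| RAnd (f g : rf)
| ROr (f g : rf)
| RImp (f g : rf)
| REx (f : rf)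
| RAll (f : rf).

(** An atom with an undefined term, or whose value does not fit below [n], is false; as an
    antecedent it makes the implication vacuous. *)
Fixpoint rsat (n : nat) (W : seq nat) (b d : nat) (rho : nat -> nat) (f : rf) : Prop :=
  match f with
  | REq t u => [/\ tdef W b rho t, tdef W b rho u, ev W b rho t < n
                 & ev W b rho t = ev W b rho u]
  | RLt t u => [/\ tdef W b rho t, tdef W b rho u, ev W b rho u < n
                 & ev W b rho t < ev W b rho u]
  | RAnd f g => rsat n W b d rho f /\ rsat n W b d rho g
  | ROr f g => rsat n W b d rho f \/ rsat n W b d rho g
  | RImp f g => rsat n W b d rho f -> rsat n W b d rho g
  | REx f => exists2 v, v < n & rsat n W b d.+1 (upd rho d v) f
  | RAll f => forall v, v < n -> rsat n W b d.+1 (upd rho d v) f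
  end.

Fixpoint rwf (d : nat) (f : rf) : bool :=
  match f with
  | REq t u | RLt t u => twf d t && twf d u
  | RAnd f g | ROr f g | RImp f g => rwf d f && rwf d g
  | REx f | RAll f => rwf d.+1 f
  end.

Fixpoint compile (d : nat) (f : rf) : fo :=
  match f with
  | REq t u => FoEx (FoAnd (fo_term d.+1 t d) (fo_term d.+1 u d))
  | RLt t u => FoEx (FoEx (FoAnd (fo_term d.+2 t d) (FoAnd (fo_term d.+2 u d.+1)
                 (FoLt d d.+1))))
  | RAnd f g => FoAnd (compile d f) (compile d g)
  | ROr f g => FoNot (FoAnd (FoNot (compile d f)) (FoNot (compile d g)))
  | RImp f g => FoNot (FoAnd (compile d f) (FoNot (compile d g)))
  | REx f => FoEx (compile d.+1 f)
  | RAll f => FoNot (FoEx (FoNot (compile d.+1 f)))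
  end.

Section Compile.
Variables x y : seq bool.
Notation w := (tape_word x y).
Notation N := (size w).
Notation W := (fields 0 w).

Lemma upd_bounded d rho u : (forall i, i < d -> rho i < N) -> u < N ->
  forall i, i < d.+1 -> upd rho d u i < N.
Proof.
move=> h lt_u i; rewrite ltnS leq_eqVlt => /orP[/eqP ->|lt_i]; first by rewrite updE.
by rewrite upd_lt // h.
Qed.

Lemma sat_last : sat w 0 id fo_last <-> exists x', x = rcons x' false.
Proof.
have succ p q : p < N -> q < N ->
    sat w 2 (upd (upd id 0 p) 1 q) (fo_succ 2 1 0) <-> p = q.+1.
  by move=> lt_p lt_q; rewrite sat_succ ?updE.
rewrite satEx; split=> [[p lt_p]|[x' ex]].
  rewrite satAnd [X in X && _]/= updE nth_sep => /andP[/eqP ep /satEx[q lt_q]].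
  rewrite satAnd => /andP[] /=; rewrite updE => /andP[_ /eqP eq].
  move/succ => /(_ lt_p lt_q); rewrite ep => e.
  have := eq; rewrite /tape_word nth_cat size_map e ltnSn (nth_map false) ?e // => -[ef].
  case/lastP: x e ef {eq ep lt_p lt_q succ} => // x' c; rewrite size_rcons => -[<-].
  by rewrite nth_rcons ltnn eqxx => ->; exists x'.
have lt_x : size x < N by rewrite size_tape_word addnS ltnS leq_addr.
have lt_x' : size x' < size x by rewrite ex size_rcons.
have lt_xN := ltn_trans lt_x' lt_x.
exists (size x) => //; rewrite satAnd [X in X && _]/= updE nth_sep eqxx andTb.
apply/satEx; exists (size x') => //; rewrite satAnd; apply/andP; split.
  rewrite /= updE lt_xN /tape_word nth_cat size_map lt_x' (nth_map false) //.
  by rewrite ex nth_rcons ltnn eqxx.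
by apply/succ; rewrite // ex size_rcons.
Qed.

Lemma sat_term1 d rho t u : (forall i, i < d -> rho i < N) -> twf d t -> u < N ->
  sat w d.+1 (upd rho d u) (fo_term d.+1 t d) <->
  tdef W (zeros x) rho t /\ ev W (zeros x) rho t = u.
Proof.
move=> lt_rho wft lt_u; rewrite sat_term //; last first.
- exact: twf_leq wft.
- exact: upd_bounded.
rewrite updE tev_upd // tevE; case: (tdef _ _ _ _); last by split=> // -[].
by split=> [[]|[_ ->]].
Qed.

Lemma sat_compile d rho f : (forall i, i < d -> rho i < N) -> rwf d f ->
  sat w d rho (compile d f) <-> rsat N W (zeros x) d rho f.
Proof.
elim: f d rho => [t u|t u|f IHf g IHg|f IHf g IHg|f IHf g IHg|f IH|f IH] d rho lt_rho wff;
  rewrite [compile _ _]/= [rsat _ _ _ _ _ _]/=; rewrite /= in wff.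
- case/andP: wff => wft wfu.
  rewrite satEx; split=> [[v lt_v]|[dt du lt e]].
    rewrite satAnd => /andP[/sat_term1 h /sat_term1 h'].
    by have [//|//|//|dt et] := h; have [//|//|//|du eu] := h'; rewrite et eu.
  exists (ev W (zeros x) rho t) => //.
  by rewrite satAnd; apply/andP; split; apply/sat_term1.
- case/andP: wff => wft wfu.
  have key a c : a < N -> c < N ->
     sat w d.+2 (upd (upd rho d a) d.+1 c) (FoAnd (fo_term d.+2 t d) (FoAnd (fo_term d.+2 u d.+1)
                 (FoLt d d.+1))) <->
     [/\ tdef W (zeros x) rho t, ev W (zeros x) rho t = a, tdef W (zeros x) rho u,
         ev W (zeros x) rho u = c & a < c].
    move=> lt_a lt_c; have hr := upd_bounded lt_rho lt_a; have hr2 := upd_bounded hr lt_c.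
    have wft1 := twf_leq (leqnSn _) wft; have wft2 := twf_leq (leqnSn _) wft1.
    have wfu1 := twf_leq (leqnSn _) wfu; have wfu2 := twf_leq (leqnSn _) wfu1.
    rewrite !satAnd sat_lt ?updE //.
    have ht : sat w d.+2 (upd (upd rho d a) d.+1 c) (fo_term d.+2 t d) <->
        tdef W (zeros x) rho t /\ ev W (zeros x) rho t = a.
      rewrite sat_term // !updE !tev_upd // tevE; case: (tdef _ _ _ _); last by split=> // -[].
      by split=> [[]|[_ ->]].
    have hu : sat w d.+2 (upd (upd rho d a) d.+1 c) (fo_term d.+2 u d.+1) <->
        tdef W (zeros x) rho u /\ ev W (zeros x) rho u = c.
      rewrite sat_term // !updE !tev_upd // tevE; case: (tdef _ _ _ _); last by split=> // -[].
      by split=> [[]|[_ ->]].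
    split=> [/and3P[/ht[? ?] /hu[? ?] ?]|[dt et du eu lt]] //.
    by apply/and3P; split=> //; [apply/ht | apply/hu].
  rewrite satEx; split=> [[a lt_a /satEx[c lt_c /key]]|[dt du lt_u lt]].
    by move=> [//|//|-> -> -> ->].
  have lt_t := ltn_trans lt lt_u.
  by exists (ev W (zeros x) rho t) => //; apply/satEx; exists (ev W (zeros x) rho u) => //; apply/key.
- by case/andP: wff => wff wfg; rewrite satAnd -IHf // -IHg //; split=> /andP.
- case/andP: wff => wff wfg; rewrite satNot satAnd !satNot negb_and !negbK -IHf // -IHg //.
  by split=> /orP.
- case/andP: wff => wff wfg; rewrite satNot satAnd satNot negb_and negbK -IHf // -IHg //.
  by rewrite -implybE; split=> /implyP.
- by rewrite satEx; split=> -[v lt_v /IH h]; exists v => //; [apply: h | apply/h];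
    rewrite //; apply: upd_bounded.
- rewrite satNot; split=> [/negP h v lt_v|h].
    apply/IH => //; first exact: upd_bounded.
    apply/negPn/negP => hn; apply: h; apply/satEx; exists v => //; by rewrite satNot.
  apply/negP => /satEx[v lt_v]; rewrite satNot => /negP; apply.
  by apply/IH => //; [exact: upd_bounded | exact: h].
Qed.

End Compile.

(* Fields: the length of the encoded list, [s], the start symbol, the number [m] of rules, the rules; then from [TBase] on the [m.+1] rule positions (the last one being the end of the input), the [s] letters of the word, and the items, four fields each. *)
Definition t1 := TS T0.
Definition t_alphabet := TGet t1.
Definition t_start := TGet (TS t1).
Definition t_nrules := TGet (TS (TS t1)).
Definition t_rule r := TGet (TAdd TBase r).
Definition t_rhs r := TGet (TS (t_rule r)).
Definition t_tag r t := TGet (TAdd (TS (TS (t_rule r))) (TAdd t t)).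
Definition t_arg r t := TGet (TS (TAdd (TS (TS (t_rule r))) (TAdd t t))).
Definition t_word := TAdd TBase (TS t_nrules).
Definition t_letter i := TGet (TAdd t_word i).
Definition t_fact n c := TGet (TAdd (TAdd t_word t_alphabet)
  (TAdd c (TAdd (TAdd n n) (TAdd n n)))).

Definition r_fact n r t i j :=
  RAnd (REq (t_fact n T0) r) (RAnd (REq (t_fact n t1) t)
    (RAnd (REq (t_fact n (TS t1)) i) (REq (t_fact n (TS (TS t1))) j))).

(** The first rule starts at field 4, each next start is the previous one plus the length of its
    rule, and the last start is the end of the input. This determines the guessed positions and
    leaves no stray field. *)
Definition r_parse :=
  RAnd (REq (TS (TGet T0)) TBase)
  (RAnd (REq (t_rule T0) (TS (TS (TS t1))))
  (RAnd (REq (t_rule t_nrules) TBase)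
  (RAnd (RAll (RImp (RLt (TV 0) t_nrules)
     (REq (t_rule (TS (TV 0)))
        (TAdd (TS (TS (t_rule (TV 0)))) (TAdd (t_rhs (TV 0)) (t_rhs (TV 0)))))))
  (RAll (RImp (RLt (TV 0) t_nrules) (RAll (RImp (RLt (TV 1) (t_rhs (TV 0)))
     (ROr (RAnd (REq (t_tag (TV 0) (TV 1)) T0)
                (RLt (t_arg (TV 0) (TV 1)) t_alphabet))
          (REq (t_tag (TV 0) (TV 1)) t1))))))))).

Definition r_pangram :=
  RAll (RImp (RLt (TV 0) t_alphabet)
    (REx (RAnd (RLt (TV 1) t_alphabet) (REq (t_letter (TV 1)) (TV 0))))).

Definition r_goal :=
  REx (REx (RAnd (RLt (TV 1) t_nrules) (RAnd (REq (TGet (t_rule (TV 1))) t_start)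
    (r_fact (TV 0) (TV 1) T0 T0 t_alphabet)))).

(** Here and up to [r_derivation], variables 0 to 4 are the index of an item and its entries [r],
    [t], [i], [j]. In [r_nonterminal], 5 is the split point and 6 the rule applied to the
    nonterminal. The innermost variable of [r_terminal] and [r_nonterminal] is an earlier item. *)
Definition r_end := RAnd (REq (t_rhs (TV 1)) (TV 2)) (REq (TV 3) (TV 4)).
Definition r_terminal :=
  RAnd (RLt (TV 2) (t_rhs (TV 1))) (RAnd (REq (t_tag (TV 1) (TV 2)) T0)
  (RAnd (REq (t_arg (TV 1) (TV 2)) (t_letter (TV 3)))
  (REx (RAnd (RLt (TV 5) (TV 0)) (r_fact (TV 5) (TV 1) (TS (TV 2)) (TS (TV 3)) (TV 4)))))).
Definition r_nonterminal :=
  RAnd (RLt (TV 2) (t_rhs (TV 1))) (RAnd (REq (t_tag (TV 1) (TV 2)) t1)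
  (REx (REx (RAnd (RLt (TV 6) t_nrules)
  (RAnd (REq (TGet (t_rule (TV 6))) (t_arg (TV 1) (TV 2)))
  (RAnd (REx (RAnd (RLt (TV 7) (TV 0)) (r_fact (TV 7) (TV 6) T0 (TV 3) (TV 5))))
        (REx (RAnd (RLt (TV 7) (TV 0)) (r_fact (TV 7) (TV 1) (TS (TV 2)) (TV 5) (TV 4)))))))))).
Definition r_derivation :=
  RAll (RAll (RAll (RAll (RAll (RImp (r_fact (TV 0) (TV 1) (TV 2) (TV 3) (TV 4))
    (ROr r_end (ROr r_terminal r_nonterminal))))))).

Definition r_check := RAnd r_parse (RAnd r_pangram (RAnd r_goal r_derivation)).
Definition checker : fo := FoAnd fo_last (compile 0 r_check).

Lemma wf_checker : wf 0 checker.
Proof. by vm_compute. Qed.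

Lemma sat_checker x y : let w := tape_word x y in
  sat w 0 id checker <->
  (exists x', x = rcons x' false) /\ rsat (size w) (fields 0 w) (zeros x) 0 id r_check.
Proof.
move=> w; rewrite /checker satAnd; split=> [/andP[/sat_last ? /sat_compile h]|[h1 h2]].
  by split=> //; apply: h.
by apply/andP; split; [apply/sat_last | apply/sat_compile].
Qed.


(** * Arithmetical meaning of the checker *)

Section Check.
Variables (W : seq nat) (b : nat).
Notation g := (nth 0 W).

Definition rule_at r := g (b + r).
Definition rhs_at r := g (rule_at r).+1.
Definition tag_pos r t := (rule_at r).+2 + (t + t).
Definition letter_pos i := b + (g 3).+1 + i.
Definition fact_pos m c := b + (g 3).+1 + g 1 + (c + (m + m + (m + m))).

Definition fact m r t i j : Prop :=
  [/\ 3 < size W, fact_pos m 3 < size W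
    & [/\ g (fact_pos m 0) = r, g (fact_pos m 1) = t, g (fact_pos m 2) = i
        & g (fact_pos m 3) = j]].

Definition parse_ok : Prop :=
  [/\ (g 0).+1 = b, 3 < size W, b + g 3 < size W, rule_at 0 = 4 & rule_at (g 3) = b] /\
  (forall r, r < g 3 -> (rule_at r).+1 < size W /\
     rule_at r.+1 = (rule_at r).+2 + (rhs_at r + rhs_at r)) /\
  (forall r, r < g 3 -> forall t, t < rhs_at r -> tag_pos r t < size W /\
     ([/\ g (tag_pos r t) = 0, (tag_pos r t).+1 < size W & g (tag_pos r t).+1 < g 1]
      \/ g (tag_pos r t) = 1)).

Definition pangram_ok : Prop := forall a, a < g 1 ->
  exists i, [/\ i < g 1, letter_pos i < size W & g (letter_pos i) = a].

Definition goal_ok : Prop := exists m r, [/\ r < g 3, rule_at r < size W,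
  g (rule_at r) = g 2 & fact m r 0 0 (g 1)].

(** The moves of a chart parser: finished rule, scanned letter, or nonterminal whose part of the
    word ends at [k]. The size conditions say that the fields read exist. *)
Definition justified m r t i j : Prop :=
  [/\ b + r < size W, (rule_at r).+1 < size W &
  [\/ rhs_at r = t /\ i = j,
      [/\ t < rhs_at r, (tag_pos r t).+1 < size W, g (tag_pos r t) = 0
        & [/\ letter_pos i < size W, g (tag_pos r t).+1 = g (letter_pos i)
            & exists2 m', m' < m & fact m' r t.+1 i.+1 j]]
    | [/\ t < rhs_at r, (tag_pos r t).+1 < size W, g (tag_pos r t) = 1
        & exists k r', [/\ r' < g 3, rule_at r' < size W,
            g (rule_at r') = g (tag_pos r t).+1,
            exists2 m', m' < m & fact m' r' 0 i k
          & exists2 m', m' < m & fact m' r t.+1 k j]]]].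

Definition derivation_ok : Prop :=
  forall m r t i j, fact m r t i j -> justified m r t i j.

Variable n : nat.
Hypotheses (g_lt : forall i, g i < n) (W_le : size W <= n).

Lemma rsat_factE d rho m r t i j :
  tdef W b rho m -> tdef W b rho r -> tdef W b rho t -> tdef W b rho i -> tdef W b rho j ->
  rsat n W b d rho (r_fact m r t i j) <->
  3 < size W /\ fact (ev W b rho m) (ev W b rho r) (ev W b rho t) (ev W b rho i) (ev W b rho j).
Proof.
move=> dm dr dt di dj; rewrite /r_fact /= dm dr dt di dj /fact /fact_pos !g_lt /=.
split=> [[[/andP[/andP[/andP[? ?] _] _] _ _ ?] [[_ _ _ ?] [[_ _ _ ?] [/andP[_ ?] _ _ ?]]]]|]; first by [].
case=> h [_ lt [e0 e1 e2 e3]]; have h1 : 1 < size W by lia.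
rewrite h h1 /= e0 e1 e2 e3.
do !split=> //; lia.
Qed.

Local Opaque r_fact.

(** The entries of an item are fields and its index is below the number of fields, so quantifiers
    bounded by [n] miss no item. *)
Lemma fact_bound m r t i j : fact m r t i j ->
  [/\ 3 < size W, m < n, r < n & [/\ t < n, i < n & j < n]].
Proof.
case=> h lt [<- <- <- <-]; rewrite !g_lt; split=> //; apply: leq_trans W_le.
by rewrite /fact_pos in lt; lia.
Qed.

Lemma rsat_goal : 3 < size W -> b + g 3 < size W -> rsat n W b 0 id r_goal <-> goal_ok.
Proof.
move=> W3 Wr; rewrite /r_goal /goal_ok /=; have W1 : 1 < size W by lia.
split.
  move=> [m lt_m [r lt_r [[_ _ _ lt] [[/andP[_ d] _ _ e] /rsat_factE]]]].
  by case=> //= _ h; exists m, r.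
move=> [m [r [lt_r d e h]]]; have [_ lt_m ltrn _] := fact_bound h.
exists m => //; exists r => //.
split; first by rewrite W3 g_lt.
split; last by apply/rsat_factE; rewrite //= W1.
rewrite /upd /= -/(rule_at r) d g_lt; split=> //; lia.
Qed.

Lemma rsat_pangram : 3 < size W -> rsat n W b 0 id r_pangram <-> pangram_ok.
Proof.
move=> W3; have W1 : 1 < size W by lia.
rewrite /r_pangram /pangram_ok /upd /= W3 W1 g_lt /=; split=> h a.
  move=> lt_a; have [||i lt_i [[_ _ _ lt] [d _ _ e]]] := h a _ _ => //.
    exact: ltn_trans lt_a (g_lt _).
  by exists i.
move=> _ [_ _ _ /h[i [lt_i d e]]]; exists i; first exact: ltn_trans lt_i (g_lt _).
by rewrite -/(letter_pos i) d g_lt.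
Qed.

Lemma rsat_parse : rsat n W b 0 id r_parse <-> parse_ok.
Proof.
rewrite /r_parse /parse_ok /upd /=; split.
  move=> [[W0 _ _ e1] [[W2 _ _ e2] [[/andP[W3 W4] _ _ e3] [h4 h5]]]].
  split; first by rewrite W3 W4 /rule_at.
  have lt_n v : v < g 3 -> v < n by move=> lt; apply: ltn_trans lt (g_lt _).
  split=> [r lt_r|r lt_r t lt_t].
    have [_ /and4P[_ /andP[_ ?] _ _] _ ?] := h4 r (lt_n _ lt_r) (And4 isT W3 (g_lt _) lt_r).
    by [].
  have [_ /and4P[d1 /andP[_ d2] _ _] _ _] := h4 r (lt_n _ lt_r) (And4 isT W3 (g_lt _) lt_r).
  have {}lt_t : [/\ true, (b + r < size W) && ((g (b + r)).+1 < size W),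
    g (g (b + r)).+1 < n & t < g (g (b + r)).+1] by rewrite d1 d2 g_lt.
  have lt_tn : t < n by case: lt_t => _ _ h1 h2; apply: ltn_trans h2 h1.
  case: (h5 r (lt_n _ lt_r) (And4 isT W3 (g_lt _) lt_r) t lt_tn lt_t).
    case=> -[/andP[_ ?] _ _ ?] [/andP[_ ?] ? _ ?].
    by split=> //; left.
  by case=> /andP[_ ?] _ _ ?; split=> //; right.
move=> [[e1 W3 W4 e2 e3] [h4 h5]]; rewrite /rule_at in e2 e3 h4 h5.
split; first by split=> //; [lia | rewrite -e1 in W4 *; lia].
split; first by rewrite e2; split=> //; [lia | rewrite -e2; apply: g_lt].
split; first by rewrite W3 W4 g_lt.
have lt_b r : r < g 3 -> b + r < size W by lia.
have lt_b' r : r < g 3 -> b + r.+1 < size W by lia.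
split=> [r _ [_ _ _ lt_r]|r _ [_ _ _ lt_r] t _ [_ _ _ lt_t]].
  by have [d e] := h4 r lt_r; rewrite lt_b' // lt_b // d g_lt.
have [d1] := h5 r lt_r t lt_t; rewrite /tag_pos /rule_at in d1 *; rewrite lt_b //=.
case=> [[e d2 lt]|e]; [left | right].
  rewrite d1 d2 !g_lt; do !split=> //; lia.
by rewrite d1 g_lt.
Qed.

Lemma rsat_derivation : b + g 3 < size W -> rsat n W b 0 id r_derivation <-> derivation_ok.
Proof.
move=> Wr; rewrite /r_derivation /derivation_ok /=; split=> h.
  move=> m r t i j hf; have [W3 lt_m lt_r [lt_t lt_i lt_j]] := fact_bound hf.
  have := h m lt_m r lt_r t lt_t i lt_i j lt_j; rewrite /upd /=.
  case; first by apply/rsat_factE.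
  - by case=> -[/andP[? ?] _ _ ?] [_ _ _ ?]; split=> //; constructor 1.
  - case=> [[[_ /andP[? ?] _ ?] [[_ _ _ ?] [[/andP[_ ?] /andP[_ ?] _ ?]]]]|].
      case=> m' _ [[_ _ _ lt] /rsat_factE]; case=> // _ h'; split=> //.
      by constructor 2; split=> //; split=> //; exists m'.
    case=> [[_ /andP[? ?] _ ?] [[_ _ _ ?] [k _ [r' _ [[_ _ _ ?]]]]]].
    case=> -[/andP[_ ?] /andP[_ ?] _ ?] [[m1 _ [[_ _ _ lt1] /rsat_factE h1]]].
    case=> m2 _ [[_ _ _ lt2] /rsat_factE h2]; split=> //.
    have W1 : 1 < size W by lia.
    constructor 3; split=> //; exists k, r'; split=> //.
      by exists m1 => //; apply h1.
    by exists m2 => //; apply h2.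
move=> m lt_m r lt_r t lt_t i lt_i j lt_j; rewrite /upd /= => /rsat_factE.
case=> //= W3 hf; have W1 : 1 < size W by lia.
have [d1 d2] := h _ _ _ _ _ hf.
rewrite /rule_at in d1 d2; rewrite d1 d2 !g_lt W3.
case=> [[e1 e2]|[lt d3 e1 [d4 e2 [m' lt' h']]]|[lt d3 e1 [k [r' [lt' d4 e2 [m1 lt1 h1] [m2 lt2 h2]]]]]].
- by left; rewrite -e2 /=; split; [rewrite -e1 | rewrite lt_i].
- right; left; rewrite /tag_pos /rule_at in d3 e1 e2.
  rewrite d3 (ltnW d3) ?g_lt -/(letter_pos _) d4; split=> //; split=> //; split=> //.
  have [_ lt_m' _ _] := fact_bound h'.
  by exists m' => //; split=> //; apply/rsat_factE.
- right; right; rewrite /tag_pos /rule_at in d3 e1 e2.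
  rewrite d3 (ltnW d3) ?g_lt; split=> //; split=> //.
  have [_ lt_m1 lt_r' [_ _ lt_k]] := fact_bound h1.
  have [_ lt_m2 _ _] := fact_bound h2.
  exists k => //; exists r' => //; split=> //.
  split; first by rewrite /rule_at in d4; rewrite d4 g_lt; split=> //; lia.
  split; first by exists m1 => //; split=> //; apply/rsat_factE.
  by exists m2 => //; split=> //; apply/rsat_factE.
Qed.

Lemma rsat_check : rsat n W b 0 id r_check <->
  [/\ parse_ok, pangram_ok, goal_ok & derivation_ok].
Proof.
rewrite /r_check [rsat _ _ _ _ _ _]/=; split.
  case=> /rsat_parse hp; have [[_ W3 Wr _ _] _] := hp.
  by case=> /rsat_pangram h1 [/rsat_goal h2 /rsat_derivation h3]; split; auto.
case=> hp h1 h2 h3; have [[_ W3 Wr _ _] _] := hp.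
split; first by apply/rsat_parse.
split; first by apply/rsat_pangram.
by split; [apply/rsat_goal | apply/rsat_derivation].
Qed.

End Check.

(** * Soundness *)

Lemma fields_cat acc u v :
  fields acc (u ++ v) = fields acc u ++ fields (pending acc u) v.
Proof. by elim: u acc => [|[[]|] u IH] acc //=; rewrite IH. Qed.

Lemma size_fields acc u : size (fields acc u) = count_mem (Some false) u.
Proof. by elim: u acc => [|[[]|] u IH] acc //=; rewrite IH. Qed.

(** A bit string is its unary blocks followed by unfinished ones; hence an input ending in a zero is
    determined by its fields. *)
Lemma unary_fields acc x :
  flatten [seq unary n | n <- fields acc (map some x)] ++
    nseq (pending acc (map some x)) true = nseq acc true ++ x.
Proof.
elim: x acc => [|[] x IH] acc /=; first by rewrite cats0.
  by rewrite IH -cat_rcons -[in LHS]addn1 nseqD -cats1.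
by rewrite -catA IH /unary cat_rcons.
Qed.

Lemma fields_unary acc n u :
  fields acc (map some (unary n) ++ u) = (acc + n) :: fields 0 u.
Proof.
rewrite /unary; elim: n acc => [|n IH] acc /=; first by rewrite addn0.
by rewrite IH addSnnS.
Qed.

Lemma fields_flatten l u :
  fields 0 (map some (flatten [seq unary n | n <- l]) ++ u) = l ++ fields 0 u.
Proof. by elim: l => //= n l IH; rewrite map_cat -catA fields_unary IH. Qed.

Lemma zeros_fields x : zeros x = size (fields 0 (map some x)).
Proof. by rewrite size_fields count_map /zeros; apply: eq_count => -[]. Qed.

Lemma fields_tape x' y : let x := rcons x' false in
  fields 0 (tape_word x y) = fields 0 (map some x) ++ fields 0 (map some y).
Proof. by rewrite /= /tape_word fields_cat map_rcons pending_rcons. Qed.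

Section Soundness.
Variables (x' y : seq bool).
Let x := rcons x' false.
Let W := fields 0 (tape_word x y).
Let X := fields 0 (map some x).
Let b := zeros x.
Notation g := (nth 0 W).
Hypotheses (parseW : parse_ok W b) (pangramW : pangram_ok W b)
  (goalW : goal_ok W b) (derivationW : derivation_ok W b).

Let symbol_at r t : sym :=
  let a := g (tag_pos W b r t).+1 in if g (tag_pos W b r t) == 0 then inl a else inr a.
Let rule r : nat * seq sym :=
  (g (rule_at W b r), [seq symbol_at r t | t <- iota 0 (rhs_at W b r)]).
Let G := CFG (g 2) [seq rule r | r <- iota 0 (g 3)].

Lemma W_cat : W = X ++ fields 0 (map some y).
Proof. exact: fields_tape. Qed.

Lemma size_X : size X = b.
Proof. by rewrite /b zeros_fields. Qed.

Lemma nth_X i : i < b -> nth 0 X i = g i.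
Proof. by move=> lt_i; rewrite W_cat nth_cat size_X lt_i. Qed.

(** The starts increase and the last one is [b], so every rule is read from the input and never from
    the certificate. *)
Lemma rule_at_le r : r <= g 3 -> rule_at W b r <= b.
Proof.
have [[_ _ _ _ e] [step _]] := parseW.
move=> le_r; rewrite -[X in _ <= X]e -(subnK le_r).
have: g 3 - r + r <= g 3 by rewrite subnK.
elim: (g 3 - r) => // k IH; rewrite addSn => lt.
apply: leq_trans (IH (ltnW lt)) _; have [_ ->] := step _ lt; lia.
Qed.

Lemma drop_X c : c < b -> drop c X = g c :: drop c.+1 X.
Proof. by move=> lt_c; rewrite (drop_nth 0) ?size_X // nth_X. Qed.

Lemma drop_rule r : r < g 3 ->
  drop (rule_at W b r) X = rule_nats (rule r) ++ drop (rule_at W b r.+1) X.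
Proof.
have [_ [step syms]] := parseW => lt_r.
have [_ e] := step _ lt_r; have le := rule_at_le lt_r; rewrite e in le.
rewrite drop_X; last by lia.
rewrite drop_X; last by lia.
rewrite /rule_nats /= size_map size_iota -/(rhs_at W b r) e; do 2 congr (_ :: _).
have: forall k t, t + k = rhs_at W b r ->
  drop ((rule_at W b r).+2 + (t + t)) X =
  flatten [seq sym_nats z | z <- [seq symbol_at r t | t <- iota t k]] ++
  drop ((rule_at W b r).+2 + (rhs_at W b r + rhs_at W b r)) X; last first.
  by move/(_ (rhs_at W b r) 0 erefl); rewrite !addn0.
elim=> [|k IH] t etk /=; first by rewrite -etk addn0.
have lt_t : t < rhs_at W b r by lia.
rewrite drop_X; last by lia.
rewrite drop_X; last by lia.
have -> : ((rule_at W b r).+2 + (t + t)).+2 = (rule_at W b r).+2 + (t.+1 + t.+1) by lia.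
rewrite IH; last by lia.
have [_ hs] := syms _ lt_r _ lt_t; rewrite /symbol_at -/(tag_pos W b r t).
by case: hs => [[-> _ _]|->].
Qed.

(** Rules tile the fields from 4 to [b] and [g 0] is the correct length, so the fields are those of
    the encoding; equality of the bits follows because the input ends in a zero. *)
Lemma encode_X : x = encode (g 1) G.
Proof.
have [[e0 W3 Wr e4 eb] _] := parseW.
have b3 : 3 < b by have := rule_at_le (leq0n (g 3)); rewrite e4.
have rest k r : r + k = g 3 -> drop (rule_at W b r) X =
    flatten [seq rule_nats z | z <- [seq rule r | r <- iota r k]].
  elim: k r => [|k IH] r erk /=.
    by rewrite -[r]addn0 erk eb drop_oversize // size_X.
  by rewrite drop_rule ?IH //; lia.
have eX : X = [:: g 0, g 1, g 2, size (rules G) & flatten [seq rule_nats z | z <- rules G]].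
  by rewrite size_map size_iota -(rest (g 3) 0 erefl) e4 -!drop_X ?drop0 //; lia.
have eb0 : g 0 = size (behead X) by rewrite size_behead size_X -e0.
transitivity (flatten [seq unary n | n <- X]).
  have := unary_fields 0 x.
  by rewrite [pending _ _](_ : _ = 0) ?cats0 // map_rcons pending_rcons.
by rewrite eX [LHS]/= eb0 eX.
Qed.

Lemma over_alphabet_G : over_alphabet (g 1) G.
Proof.
have [_ [_ syms]] := parseW.
apply/allP => p /mapP[r]; rewrite mem_iota => /andP[_ lt_r] ->.
apply/allP => z /mapP[t]; rewrite mem_iota => /andP[_ lt_t] ->.
have [_] := syms _ lt_r _ lt_t; rewrite /symbol_at.
by case=> [[-> _ ?]|->].
Qed.

Let letter i := g (letter_pos W b i).
Let factor i j : seq sym := [seq inl (letter k) | k <- iota i (j - i)].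

Lemma derives_cat u1 v1 u2 v2 : derives G u1 v1 -> derives G u2 v2 ->
  derives G (u1 ++ u2) (v1 ++ v2).
Proof.
have ctx l r u v : derives G u v -> derives G (l ++ u ++ r) (l ++ v ++ r).
  elim=> [u1' v1' [l' [r' [A [rhs [h [-> ->]]]]]]|u'|u' v' z _ h1 _ h2].
  - apply: rt_step; exists (l ++ l'), (r' ++ r), A, rhs; split=> //.
    by rewrite -!catA.
  - exact: rt_refl.
  - exact: rt_trans h1 h2.
move=> h1 h2; apply: (@rt_trans _ _ _ (v1 ++ u2)).
  exact: (ctx [::] u2).
by have := ctx v1 [::] _ _ h2; rewrite !cats0.
Qed.

(** Strong induction on the index, as justifications point to smaller indices. The inequality
    [i <= j] is not checked by the formula; it comes out of the same induction and is what lets the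
    factors be concatenated. *)
Lemma fact_sound m r t i j : r < g 3 -> fact W b m r t i j ->
  i <= j /\ derives G (drop t (rule r).2) (factor i j).
Proof.
elim/ltn_ind: m r t i j => m IH r t i j lt_r /derivationW[_ _].
have rhs_drop : t < rhs_at W b r ->
    drop t (rule r).2 = symbol_at r t :: drop t.+1 (rule r).2.
  move=> lt_t; rewrite (drop_nth (symbol_at r 0)) ?size_map ?size_iota //.
  by rewrite (nth_map 0) ?size_iota // nth_iota.
case=> [[<- <-]|[lt_t _ etag [_ earg [m' lt_m hf]]]|[lt_t _ etag [k [r' [lt_r' _ elhs [m1 lt_m1 h1] [m2 lt_m2 h2]]]]]].
- split=> //; rewrite /factor subnn drop_oversize ?size_map ?size_iota //; exact: rt_refl.
- have [lt_ij hd] := IH _ lt_m _ _ _ _ lt_r hf; split; first exact: ltnW.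
  rewrite rhs_drop // /symbol_at etag /= earg /factor -(subnSK lt_ij) /=.
  by apply: (derives_cat (u1 := [:: _]) (v1 := [:: _])) hd; apply: rt_refl.
- have [le1 hd1] := IH _ lt_m1 _ _ _ _ lt_r' h1.
  have [le2 hd2] := IH _ lt_m2 _ _ _ _ lt_r h2; split; first exact: leq_trans le2.
  rewrite rhs_drop // /symbol_at etag /= -elhs.
  have -> : factor i j = factor i k ++ factor k j.
    rewrite /factor -map_cat; congr map.
    have -> : j - i = (k - i) + (j - k) by lia.
    by rewrite iotaD subnKC.
  apply: (derives_cat (u1 := [:: _])) hd2; rewrite drop0 in hd1.
  apply: rt_trans hd1; apply: rt_step.
  exists [::], [::], (g (rule_at W b r')), (rule r').2; split; last by rewrite cats0.
  by apply/mapP; exists r'; rewrite ?mem_iota.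
Qed.

Lemma check_sound : PANGRAM_CFG x.
Proof.
exists (g 1), G; split; first exact: encode_X.
split; first exact: over_alphabet_G.
set w := [seq letter i | i <- iota 0 (g 1)]; exists w; split.
  have [m [r [lt_r _ elhs /(fact_sound lt_r)]]] := goalW.
  rewrite drop0 /factor subn0 => -[_ hd].
  rewrite /in_lang /w -map_comp; apply: rt_trans hd; apply: rt_step.
  exists [::], [::], (g 2), (rule r).2; split; last by rewrite cats0.
  by apply/mapP; exists r; rewrite ?mem_iota // /rule elhs.
(* Pigeonhole: [s] positions covering [s] letters leave no room for a repetition or for a value
   outside the alphabet. *)
have sub : {subset iota 0 (g 1) <= w}.
  move=> a; rewrite mem_iota => /andP[_ /pangramW[i [lt_i _ <-]]].
  by apply: map_f; rewrite mem_iota.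
have sz : size w <= size (iota 0 (g 1)) by rewrite size_map.
have uw := leq_size_uniq (iota_uniq _ _) sub sz.
have [_ eqw] := uniq_min_size (iota_uniq _ _) sub sz.
apply/andP; split; apply/allP => a.
  by rewrite -eqw mem_iota.
by move/sub => aw; rewrite count_uniq_mem // aw.
Qed.

End Soundness.

(** * Completeness *)

(** Derivation forests. Induction on them splits the word along the symbols, as chart items do,
    whereas [derives] rewrites anywhere in the string. *)
Inductive yields (G : cfg) : seq sym -> seq nat -> Prop :=
| yields_nil : yields G [::] [::]
| yields_letter a u v : yields G u v -> yields G (inl a :: u) (a :: v)
| yields_rule A rhs u v1 v2 : (A, rhs) \in rules G ->
    yields G rhs v1 -> yields G u v2 -> yields G (inr A :: u) (v1 ++ v2).

Section Yields.
Variable G : cfg.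

Lemma yields_cat u v u' v' :
  yields G u v -> yields G u' v' -> yields G (u ++ u') (v ++ v').
Proof.
move=> h h'; elim: h => //= [a u1 v1 _ IH|A rhs u1 v1 v2 hA hr _ _ IH].
  exact: yields_letter.
by rewrite -catA; apply: yields_rule hA hr IH.
Qed.

Lemma yields_catE u u' v : yields G (u ++ u') v ->
  exists v1 v2, [/\ v = v1 ++ v2, yields G u v1 & yields G u' v2].
Proof.
elim: u v => [|z u IH] v /=; first by exists [::], v; split=> //; apply: yields_nil.
move e: (z :: u ++ u') => zu h; case: h e => // [a u1 v1 h|A rhs u1 v1 v2 hA hr h] [ez eu].
  rewrite -eu in h; have [v2 [v3 [-> h2 h3]]] := IH _ h.
  by exists (a :: v2), v3; rewrite ez; split=> //; apply: yields_letter.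
rewrite -eu in h; have [v3 [v4 [-> h3 h4]]] := IH _ h.
by exists (v1 ++ v3), v4; rewrite ez catA; split=> //; apply: yields_rule hA hr h3.
Qed.

(** A rewriting step read backwards puts a node on top of the forest grown from [rhs]. *)
Lemma derives_yields u z v : derives G u z -> yields G z v -> yields G u v.
Proof.
move=> h; elim: h v => [u1 z1 [l [r [A [rhs [hA [-> ->]]]]]]|//|u1 u2 u3 _ IH1 _ IH2] v.
  case/yields_catE=> v1 [v2 [-> h1 /yields_catE[v3 [v4 [-> h3 h4]]]]].
  exact: yields_cat h1 (yields_rule hA h3 h4).
by move/IH2/IH1.
Qed.

Lemma in_lang_yields v : in_lang G v -> yields G [:: inr (start G)] v.
Proof.
move/derives_yields; apply; elim: v => [|a v IH] /=; first exact: yields_nil.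
exact: yields_letter.
Qed.

End Yields.

(** * Charts *)

Definition item : Type := (nat * nat * nat * nat)%type.

Section Items.
Variables (G : cfg) (w : seq nat).
Notation R := (rules G).
Definition lhs_of r : nat := (nth (0, [::]) R r).1.
Definition rhs_of r : seq sym := (nth (0, [::]) R r).2.

(** The four bounds confine every entry of an item to a range that is linear in the input; the count
    of possible items rests on this. *)
Definition supported (F : seq item) (f : item) : Prop :=
  let: (r, t, i, j) := f in
  [/\ r < size R, t <= size (rhs_of r), i <= j, j <= size w &
  [\/ t = size (rhs_of r) /\ i = j,
      [/\ t < size (rhs_of r), i < size w, nth (inl 0) (rhs_of r) t = inl (nth 0 w i)
        & (r, t.+1, i.+1, j) \in F]
    | [/\ t < size (rhs_of r) & exists k r', [/\ r' < size R,
        nth (inl 0) (rhs_of r) t = inr (lhs_of r'),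
        (r', 0, i, k) \in F & (r, t.+1, k, j) \in F]]]].

(* Charts list the most recent item first. *)
Fixpoint valid (F : seq item) : Prop :=
  if F is f :: F then supported F f /\ valid F else True.

Lemma supported_sub (F F' : seq item) f :
  {subset F <= F'} -> supported F f -> supported F' f.
Proof.
case: f => -[[r t] i] j sub [h1 h2 h3 h4 h]; split=> //.
case: h => [?|[? ? ? /sub ?]|[? [k [r' [? ? /sub ? /sub ?]]]]].
- by constructor 1.
- by constructor 2.
- by constructor 3; split=> //; exists k, r'.
Qed.

Lemma valid_cat F F' : valid F -> valid F' -> valid (F ++ F').
Proof.
elim: F => //= f F IH [hf hF] hF'; split; last exact: IH.
by apply: supported_sub hf => z; rewrite mem_cat => ->.
Qed.

(** [undup] keeps the last occurrence, which is the item derived first, and its premises survive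
    behind it. *)
Lemma valid_undup F : valid F -> valid (undup F).
Proof.
elim: F => //= f F IH [hf hF]; case: ifP => _; first exact: IH.
by split; [apply: supported_sub hf => z; rewrite mem_undup | apply: IH].
Qed.

(** Reversal gives the order of the certificate, where the premises of item [m] stand at indices
    below [m]. *)
Lemma valid_nth F f0 m : valid F -> m < size F ->
  supported (take m (rev F)) (nth f0 (rev F) m).
Proof.
elim: F => //= f F IH [hf hF]; rewrite ltnS leq_eqVlt rev_cons nth_rcons -cats1.
rewrite size_rev => /orP[/eqP ->|lt_m].
  rewrite ltnn eqxx take_cat size_rev ltnn subnn cats0.
  by apply: supported_sub hf => z; rewrite mem_rev.
by rewrite lt_m take_cat size_rev lt_m; apply: IH.
Qed.

(** The chart follows the whole forest, repetitions included, so nothing is said about its length;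
    duplicates are removed afterwards. *)
Lemma yields_valid u v r t i j : yields G u v ->
  r < size R -> t <= size (rhs_of r) -> drop t (rhs_of r) = u ->
  i <= j -> j <= size w -> v = [seq nth 0 w k | k <- iota i (j - i)] ->
  exists2 F, valid F & (r, t, i, j) \in F.
Proof.
move=> h; elim: h r t i j => [|a u1 v1 h IH|A rhs u1 v1 v2 hA h1 IH1 h2 IH2] r t i j lt_r le_t eu le_ij le_j ev.
- have et : t = size (rhs_of r).
    by apply/eqP; rewrite eqn_leq le_t -subn_eq0 -size_drop eu.
  have eij : i = j.
    apply/eqP; rewrite eqn_leq le_ij -subn_eq0.
    by rewrite -(size_iota i (j - i)) -(size_map (nth 0 w)) -ev.
  by exists [:: (r, t, i, j)]; rewrite ?mem_head //=; split=> //; split=> //; constructor 1.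
- have lt_t : t < size (rhs_of r) by rewrite -subn_gt0 -size_drop eu.
  have lt_ij : i < j.
    by rewrite -subn_gt0 -(size_iota i (j - i)) -(size_map (nth 0 w)) -ev.
  rewrite -(subnSK lt_ij) /= in ev; case: ev => ea ev.
  rewrite (drop_nth (inl 0)) // in eu; case: eu => ez eu.
  have [F vF hF] := IH r t.+1 i.+1 j lt_r lt_t eu lt_ij le_j ev.
  exists ((r, t, i, j) :: F); rewrite ?mem_head //=; split=> //; split=> //.
  by constructor 2; split=> //; [exact: leq_trans le_j | rewrite ez ea].
- have lt_t : t < size (rhs_of r) by rewrite -subn_gt0 -size_drop eu.
  rewrite (drop_nth (inl 0)) // in eu; case: eu => ez eu.
  have sv : size v1 + size v2 = j - i by rewrite -size_cat ev size_map size_iota.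
  (* The split point is where the yield of the leading nonterminal ends. *)
  set k := i + size v1; have le_kj : k <= j by rewrite /k; lia.
  have lt_r' := hA; rewrite -index_mem in lt_r'; set r' := index _ _ in lt_r'.
  have er' : nth (0, [::]) R r' = (A, rhs) by apply: nth_index.
  move: ev; rewrite -sv iotaD map_cat -/k => /eqP.
  rewrite eqseq_cat ?size_map ?size_iota // => /andP[/eqP ev1 /eqP ev2].
  have [||||||F1 vF1 hF1] := IH1 r' 0 i k; rewrite /rhs_of ?er' ?drop0 //.
  - exact: leq_addr.
  - exact: leq_trans le_j.
  - by rewrite /k addKn.
  have [||||||F2 vF2 hF2] := IH2 r t.+1 k j => //.
    by rewrite ev2; congr [seq _ | _ <- iota _ _]; rewrite /k; lia.
  exists ((r, t, i, j) :: F1 ++ F2); rewrite ?mem_head //=.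
  split; last exact: valid_cat.
  split=> //; constructor 3; split=> //; exists k, r'; rewrite !mem_cat hF1 hF2 orbT.
  by split=> //; rewrite ez /lhs_of er'.
Qed.

End Items.

Lemma drop_flatten_shape (T : Type) (ss : seq (seq T)) r :
  drop (sumn (map size (take r ss))) (flatten ss) = flatten (drop r ss).
Proof.
elim: ss r => [|s ss IH] [|r] //=; rewrite ?drop0 //.
by rewrite drop_cat ltnNge leq_addr /= addKn IH.
Qed.

Definition tag_of (z : sym) := if z is inl _ then 0 else 1.
Definition arg_of (z : sym) := match z with inl a | inr a => a end.

Lemma nth_sym_nats z0 u rest t : t < size u ->
  nth 0 (flatten [seq sym_nats z | z <- u] ++ rest) (t + t) = tag_of (nth z0 u t) /\
  nth 0 (flatten [seq sym_nats z | z <- u] ++ rest) (t + t).+1 = arg_of (nth z0 u t).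
Proof.
elim: u t => // z u IH [|t] /=; first by case: z.
by rewrite ltnS addnS => /IH; case: z.
Qed.

Lemma size_sym_nats u : size (flatten [seq sym_nats z | z <- u]) = size u + size u.
Proof. by elim: u => //= -[a|A] u IH /=; rewrite IH; lia. Qed.

Lemma size_unaries l : size (flatten [seq unary n | n <- l]) = sumn l + size l.
Proof.
elim: l => //= n l IH; rewrite size_cat IH size_rcons size_nseq; lia.
Qed.

Lemma pangram_perm s w : perfect_pangram s w -> perm_eq w (iota 0 s).
Proof.
case/andP=> /allP ws /allP h1.
have memw a : (a \in w) = (a < s).
  apply/idP/idP => [/ws //|lt]; rewrite -has_pred1 has_count.
  by rewrite (eqP (h1 a _)) // mem_iota.
apply: uniq_perm; rewrite ?iota_uniq //; last by move=> a; rewrite memw mem_iota.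
apply: count_mem_uniq => a; rewrite memw; case: ltnP => [lt|le].
  by rewrite (eqP (h1 a _)) // mem_iota.
by apply/count_memPn; rewrite memw -leqNgt.
Qed.

(** * The certificate of a pangram passes the checks *)

Section Certificate.
Variables (s : nat) (G : cfg) (w : seq nat) (F : seq item).
Hypotheses (overG : over_alphabet s G) (pangram_w : perfect_pangram s w)
  (uniqF : uniq F) (validF : valid G w F).
Notation R := (rules G).

Let l := s :: start G :: size R :: flatten [seq rule_nats z | z <- R].
Let X := size l :: l.
Let rule_start r := 4 + sumn [seq size (rule_nats z) | z <- take r R].
Let item_nats (f : item) := let: (r, t, i, j) := f in [:: r; t; i; j].
Definition certificate : seq nat :=
  [seq rule_start r | r <- iota 0 (size R).+1] ++ w ++ flatten [seq item_nats f | f <- rev F].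
Let Y := certificate.
Let W := X ++ Y.
Let b := size X.
Notation g := (nth 0 W).

Lemma size_w : size w = s.
Proof. by rewrite (perm_size (pangram_perm pangram_w)) size_iota. Qed.

Lemma g_X i : i < b -> g i = nth 0 X i.
Proof. by move=> lt_i; rewrite /W nth_cat -/b lt_i. Qed.

Lemma drop_rule_start r : drop (rule_start r) X = flatten [seq rule_nats z | z <- drop r R].
Proof.
rewrite /X /l /= map_drop -drop_flatten_shape -map_take -map_comp.
by [].
Qed.

Lemma rule_start_le r : rule_start r <= b.
Proof.
have e : sumn (map size (take r (map rule_nats R))) = sumn [seq size (rule_nats z) | z <- take r R].
  by rewrite -map_take -map_comp.
rewrite /rule_start -e /b /= !addSn !ltnS add0n size_flatten /shape.
by rewrite -[X in _ <= sumn (map _ X)](cat_take_drop r) map_cat sumn_cat leq_addr.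
Qed.

Lemma rule_start_end : rule_start (size R) = b.
Proof.
rewrite /rule_start take_size /b /= !addSn add0n size_flatten /shape -map_comp.
by [].
Qed.

Lemma rule_startS r : r < size R ->
  rule_start r.+1 = rule_start r + size (rule_nats (nth (0, [::]) R r)).
Proof.
by move=> lt_r; rewrite /rule_start (take_nth (0, [::])) // map_rcons sumn_rcons addnA.
Qed.

Lemma b_gt3 : 3 < b. Proof. by []. Qed.
Lemma nrules_field : g 3 = size R. Proof. by []. Qed.
Lemma alphabet_field : g 1 = s. Proof. by []. Qed.

Lemma rule_atE r : r <= size R -> rule_at W b r = rule_start r.
Proof.
move=> le_r; rewrite /rule_at /W nth_cat ltnNge leq_addr /= -/b addKn.
rewrite /Y nth_cat size_map size_iota ltnS le_r (nth_map 0) ?size_iota ?ltnS //.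
by rewrite nth_iota.
Qed.

Lemma g_rule r c : r < size R -> c < size (rule_nats (nth (0, [::]) R r)) ->
  rule_start r + c < b /\ g (rule_start r + c) = nth 0 (rule_nats (nth (0, [::]) R r)) c.
Proof.
move=> lt_r lt_c; have lt_b : rule_start r + c < b.
  by apply: leq_trans (rule_start_le r.+1); rewrite rule_startS // ltn_add2l.
split=> //; rewrite g_X // -nth_drop drop_rule_start (drop_nth (0, [::])) //.
by rewrite -[flatten _]/(rule_nats _ ++ flatten _) nth_cat lt_c.
Qed.

Lemma size_rule r : size (rule_nats (nth (0, [::]) R r)) = 2 + (size (rhs_of G r) + size (rhs_of G r)).
Proof. by rewrite /rule_nats /= size_sym_nats. Qed.

Lemma g_lhs r : r < size R ->
  rule_at W b r < b /\ g (rule_at W b r) = lhs_of G r.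
Proof.
move=> lt_r; rewrite rule_atE ?(ltnW lt_r) //.
by have := @g_rule r 0 lt_r; rewrite addn0; apply.
Qed.

Lemma g_rhs r : r < size R ->
  (rule_at W b r).+1 < b /\ rhs_at W b r = size (rhs_of G r).
Proof.
move=> lt_r; rewrite /rhs_at rule_atE ?(ltnW lt_r) //.
by have := @g_rule r 1 lt_r; rewrite addn1; apply.
Qed.

Lemma g_sym r t : r < size R -> t < size (rhs_of G r) ->
  [/\ (tag_pos W b r t).+1 < b, g (tag_pos W b r t) = tag_of (nth (inl 0) (rhs_of G r) t)
    & g (tag_pos W b r t).+1 = arg_of (nth (inl 0) (rhs_of G r) t)].
Proof.
move=> lt_r lt_t; rewrite /tag_pos rule_atE ?(ltnW lt_r) //.
have sz := size_rule r.
have [|_ e1] := @g_rule r (2 + (t + t)) lt_r; first by lia.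
have [|h e2] := @g_rule r (2 + (t + t).+1) lt_r; first by lia.
have -> : (rule_start r).+2 + (t + t) = rule_start r + (2 + (t + t)) by lia.
have eS : (rule_start r + (2 + (t + t))).+1 = rule_start r + (2 + (t + t).+1) by lia.
rewrite eS e1 e2; have := @nth_sym_nats (inl 0) (rhs_of G r) [::] t lt_t; rewrite cats0.
by case=> /= <- <-.
Qed.

Lemma letter_posE i : i < s -> letter_pos W b i < size W /\ g (letter_pos W b i) = nth 0 w i.
Proof.
move=> lt_i; rewrite /letter_pos nrules_field.
have szY : size Y = (size R).+1 + (s + size (flatten [seq item_nats f | f <- rev F])).
  by rewrite /Y !size_cat size_map size_iota size_w.
split; first by rewrite /W size_cat szY -/b; lia.
rewrite /W nth_cat -/b ifN; last by lia.
rewrite /Y nth_cat size_map size_iota ifN; last by lia.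
rewrite nth_cat size_w ifT; last by lia.
by congr nth; lia.
Qed.

Lemma size_item_nats (fs : seq item) : size (flatten [seq item_nats f | f <- fs]) = 4 * size fs.
Proof. by elim: fs => // -[[[r t] i] j] fs IH; rewrite /= IH mulnS. Qed.

Lemma nth_item_nats (fs : seq item) m c : c < 4 -> m < size fs ->
  nth 0 (flatten [seq item_nats f | f <- fs]) (c + (m + m + (m + m))) =
  nth 0 (item_nats (nth (0, 0, 0, 0) fs m)) c.
Proof.
move=> lt_c; elim: fs m => // f fs IH [|m] lt_m /=.
  by case: f {lt_m} => -[[r t] i] j; rewrite !addn0 nth_cat [size _]/= lt_c.
have -> : c + (m.+1 + m.+1 + (m.+1 + m.+1)) = 4 + (c + (m + m + (m + m))) by lia.
by rewrite -IH //; case: f {lt_m} => -[[r t] i] j.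
Qed.

Lemma size_W : size W = b + (size R).+1 + s + 4 * size F.
Proof.
by rewrite /W size_cat /Y !size_cat size_map size_iota size_w size_item_nats size_rev -/b !addnA.
Qed.

(** The chart is the end of the certificate, so an item that fits on the tape is one of [F]. *)
Lemma factE m r t i j :
  fact W b m r t i j <-> m < size F /\ nth (0, 0, 0, 0) (rev F) m = (r, t, i, j).
Proof.
have pos c : c < 4 -> m < size F -> g (fact_pos W b m c) =
    nth 0 (item_nats (nth (0, 0, 0, 0) (rev F) m)) c.
  move=> lt_c lt_m; rewrite /fact_pos nrules_field alphabet_field.
  rewrite /W nth_cat -/b ifN; last by lia.
  rewrite /Y nth_cat size_map size_iota ifN; last by lia.
  rewrite nth_cat size_w ifN; last by lia.
  by rewrite -nth_item_nats ?size_rev //; congr nth; lia.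
rewrite /fact size_W; split=> [[_ lt [e0 e1 e2 e3]]|[lt e]].
  have lt_m : m < size F by rewrite /fact_pos nrules_field alphabet_field in lt; lia.
  split=> //; move: e0 e1 e2 e3; rewrite !pos //.
  by case: (nth (0, 0, 0, 0) (rev F) m) => -[[r' t'] i'] j' /= -> -> -> ->.
rewrite !pos // e /=; have b3 := b_gt3; split=> //.
by rewrite /fact_pos nrules_field alphabet_field; lia.
Qed.

Lemma memF r t i j m : (r, t, i, j) \in take m (rev F) -> m < size F ->
  exists2 m', m' < m & fact W b m' r t i j.
Proof.
move=> h lt_m; set T := take m (rev F) in h.
have sT : size T = m by rewrite size_takel // size_rev ltnW.
have lt' : index (r, t, i, j) T < m by rewrite -sT index_mem.
exists (index (r, t, i, j) T) => //; apply/factE; split; first exact: ltn_trans lt_m.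
by rewrite -(nth_take _ lt') nth_index.
Qed.

Lemma parse_cert : parse_ok W b.
Proof.
split; [|split].
- split=> //; rewrite ?size_W ?nrules_field ?rule_atE ?rule_start_end //; have b3 := b_gt3; try lia.
  by rewrite /rule_start take0.
- move=> r; rewrite nrules_field => lt_r; have [h ->] := g_rhs lt_r.
  split; first by rewrite size_W; lia.
  by rewrite !rule_atE ?(ltnW lt_r) // rule_startS // size_rule; lia.
- move=> r; rewrite nrules_field => lt_r t; have [_ ->] := g_rhs lt_r => lt_t.
  have [h -> ->] := g_sym lt_r lt_t; have leW : b <= size W by rewrite size_W; lia.
  split; first by lia.
  have := mem_nth (inl 0) lt_t; set z := nth _ _ _ => hz.
  have /allP/(_ _ (mem_nth (0, [::]) lt_r))/allP/(_ _ hz) := overG.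
  case: z {hz} => [a|A] h'; [left | by right].
  by split=> //; lia.
Qed.

Lemma pangram_cert : pangram_ok W b.
Proof.
move=> a; rewrite alphabet_field => lt_a.
have aw : a \in w by rewrite (perm_mem (pangram_perm pangram_w)) mem_iota.
have lt_i : index a w < s by rewrite -size_w index_mem.
by have [h e] := letter_posE lt_i; exists (index a w); rewrite e nth_index.
Qed.

Lemma derivation_cert : derivation_ok W b.
Proof.
move=> m r t i j /factE[lt_m e].
have := valid_nth (0, 0, 0, 0) validF lt_m; rewrite e.
case=> lt_r le_t le_ij le_j h.
have leW : b <= size W by rewrite size_W; lia.
have [d1 er] := g_rhs lt_r; rewrite /justified er; split; try by rewrite ?size_W; lia.
case: h => [[-> ->]|[lt_t lt_i ez hf]|[lt_t [k [r' [lt_r' ez h1 h2]]]]].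
- by constructor 1.
- have [d2 etag earg] := g_sym lt_r lt_t; rewrite ez in etag earg.
  rewrite size_w in lt_i; have [d3 el] := letter_posE lt_i.
  constructor 2; split=> //; first by lia.
  by rewrite earg el [arg_of _]/=; split=> //; apply: memF.
- have [d2 etag earg] := g_sym lt_r lt_t; rewrite ez in etag earg.
  constructor 3; split=> //; first by lia.
  have [d4 el] := g_lhs lt_r'.
  exists k, r'; rewrite earg el [arg_of _]/=; split=> //; first by lia.
    exact: memF h1 lt_m.
  exact: memF h2 lt_m.
Qed.

Lemma goal_cert r : r < size R -> lhs_of G r = start G -> (r, 0, 0, s) \in F -> goal_ok W b.
Proof.
move=> lt_r el hF; have [d e] := g_lhs lt_r.
rewrite -mem_rev in hF; exists (index (r, 0, 0, s) (rev F)), r; split=> //.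
- by rewrite size_W; lia.
- by rewrite e el.
apply/factE; rewrite alphabet_field nth_index //; split=> //.
by rewrite -size_rev index_mem.
Qed.

End Certificate.

(** * Length of the certificate *)

Lemma encode_unaries s G : encode s G = flatten [seq unary n |
  n <- let l := s :: start G :: size (rules G) :: flatten [seq rule_nats r | r <- rules G] in
       size l :: l].
Proof. by []. Qed.

Lemma unaries_rcons n l : exists x', flatten [seq unary m | m <- n :: l] = rcons x' false.
Proof.
elim/last_ind: l => [|l m _]; first by exists (nseq n true); rewrite /= cats0.
exists (flatten [seq unary m | m <- n :: l] ++ nseq m true).
by rewrite -rcons_cons map_rcons flatten_rcons /unary rcons_cat.
Qed.

Lemma field_lt x y i : nth 0 (fields 0 (tape_word x y)) i < size (tape_word x y).
Proof.
case: (ltnP i (size (fields 0 (tape_word x y)))) => [lt|le].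
  have /onth_fields_lt[] // : onth (fields 0 (tape_word x y)) i =
    Some (nth 0 (fields 0 (tape_word x y)) i) by rewrite onth_size lt.
by rewrite nth_default // size_tape_word addnS.
Qed.

Lemma size_fields_leq x y : size (fields 0 (tape_word x y)) <= size (tape_word x y).
Proof. by rewrite size_fields count_size. Qed.

(** At most [n + 1] rule positions, [n] letters and 4 entries for each of the [(n + 1) ^ 4] possible
    items; every number is at most [n] and takes at most [n + 1] bits. *)
Definition cert_size (n : nat) : nat :=
  (n + 1 + (n + 4 * ((n + 1) * (n + 1) * (n + 1) * (n + 1)))) * (n + 1).

Lemma polyb_cert_size : polyb cert_size.
Proof.
have p1 : polyb (fun n => n + 1) := polybD polyb_id (polyb_const 1).
have p4 := polybM (polybM (polybM p1 p1) p1) p1.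
exact: polybM (polybD p1 (polybD polyb_id (polybM (polyb_const 4) p4))) p1.
Qed.

Lemma sumn_bound (l : seq nat) n : all (fun a => a <= n) l -> sumn l + size l <= size l * (n + 1).
Proof. elim: l => //= a l IH /andP[le_a /IH h]; rewrite mulSn; lia. Qed.

Lemma size_items (F : seq item) n : uniq F ->
  (forall r t i j, (r, t, i, j) \in F -> [/\ r <= n, t <= n, i <= n & j <= n]) ->
  size F <= (n + 1) * (n + 1) * (n + 1) * (n + 1).
Proof.
move=> uF bF; pose I := iota 0 (n + 1).
have memI a : a <= n -> a \in I by rewrite mem_iota addn1 ltnS.
have : {subset F <= [seq (p, j) | p <- [seq (q, i) | q <- [seq (r, t) | r <- I, t <- I], i <- I], j <- I]}.
  move=> [[[r t] i] j] /bF[hr ht hi hj]; apply: allpairs_f (memI _ hj).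
  apply: allpairs_f (memI _ hi); exact: allpairs_f (memI _ hr) (memI _ ht).
by move/(uniq_leq_size uF); rewrite !size_allpairs !size_iota.
Qed.

Lemma valid_mem G w F f : valid G w F -> f \in F -> exists F', supported G w F' f.
Proof.
elim: F => //= f' F IH [hf hF]; rewrite inE => /orP[/eqP ->|]; first by exists F.
exact: IH.
Qed.

(** The root of the derivation tree supplies the rule [r] for the start symbol that [goal_ok] asks
    for. *)
Lemma lang_items G w : in_lang G w -> exists r F,
  [/\ r < size (rules G), lhs_of G r = start G, valid G w F & (r, 0, 0, size w) \in F].
Proof.
move/in_lang_yields; move e: [:: inr _] => u h.
case: h e => // A rhs u' v1 v2 hA h1 h2 [eA eu']; rewrite -eu' -eA in hA h2 *.
have -> : v1 ++ v2 = v1.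
  by move e: [::] h2 => u2 h2; case: h2 e => //; rewrite cats0.
have lt_r := hA; rewrite -index_mem in lt_r; set r := index _ _ in lt_r.
have er : nth (0, [::]) (rules G) r = (start G, rhs) by apply: nth_index.
have [||||||F vF hF] := @yields_valid G v1 rhs v1 r 0 0 (size v1) h1; rewrite /rhs_of ?er ?drop0 //.
  rewrite subn0; apply/esym; exact: mkseq_nth.
by exists r, F; rewrite /lhs_of er.
Qed.

Lemma pangram_complete x : PANGRAM_CFG x ->
  exists2 y, size y <= cert_size (size x) & sat (tape_word x y) 0 id checker.
Proof.
case=> s [G [ex [overG [w [/lang_items[r [F0 [lt_r er vF0 hF0]]] pang]]]]].
have sw : size w = s by rewrite (perm_size (pangram_perm pang)) size_iota.
rewrite sw in hF0.
set n := size x; set l := s :: start G :: size (rules G) ::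
  flatten [seq rule_nats r | r <- rules G].
have szx : n = size l + sumn l + (size l).+1.
  by rewrite /n ex encode_unaries size_unaries.
(* Unary coding makes each encoded number, and the number of fields, at most the input length. *)
have le_s : s <= n by rewrite szx /=; lia.
have le_R : size (rules G) <= n by rewrite szx /=; lia.
have le_b : (size l).+1 <= n by rewrite szx; lia.
have uF := undup_uniq F0; have vF := valid_undup vF0.
set F := undup F0 in uF vF.
have hF : (r, 0, 0, s) \in F by rewrite mem_undup.
have bF r' t i j : (r', t, i, j) \in F -> [/\ r' <= n, t <= n, i <= n & j <= n].
  case/(valid_mem vF) => F' [lt_r' le_t le_ij]; rewrite sw => le_j _.
  (* The rule occupies input fields up to [rule_start r'.+1], which is at most the number of
     fields. *)
  have le_k : size (rhs_of G r') <= n.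
    have := rule_start_le s G r'.+1; rewrite rule_startS // size_rule /=.
    by move: le_b; rewrite /l /=; lia.
  by split; lia.
set Y := certificate G w F; exists (flatten [seq unary m | m <- Y]).
  rewrite size_unaries; apply: (@leq_trans (size Y * (n + 1))).
    apply: sumn_bound; rewrite /Y /certificate !all_cat; apply/and3P; split.
    - apply/allP => _ /mapP[k _ ->]; apply: leq_trans le_b; exact: rule_start_le.
    - apply/allP => a; rewrite (perm_mem (pangram_perm pang)) mem_iota; lia.
    - by apply/allP => a /flattenP[_ /mapP[[[[r' t] i] j] hm ->]];
        rewrite mem_rev in hm; have [? ? ? ?] := bF _ _ _ _ hm;
        rewrite !inE => /or4P[] /eqP ->.
  rewrite /cert_size leq_mul2r; apply/orP; right.
  rewrite /Y /certificate !size_cat size_map size_iota sw size_item_nats size_rev.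
  by have := size_items uF bF; lia.
have WE : fields 0 (tape_word x (flatten [seq unary m | m <- Y])) = (size l :: l) ++ Y.
  rewrite ex encode_unaries /tape_word fields_flatten; congr (_ ++ _).
  by have := fields_flatten Y [::]; rewrite !cats0.
have zx : zeros x = size (size l :: l).
  by rewrite zeros_fields ex encode_unaries -[X in fields 0 X]cats0 fields_flatten cats0.
apply/sat_checker; split; first by rewrite ex encode_unaries; apply: unaries_rcons.
apply/rsat_check; [exact: field_lt | exact: size_fields_leq | rewrite WE zx; split].
- exact: parse_cert.
- exact: pangram_cert.
- exact: goal_cert hF.
- exact: derivation_cert.
Qed.

Theorem mainTheorem7 : in_NP PANGRAM_CFG.
Proof.
apply: (fo_in_NP wf_checker polyb_cert_size pangram_complete) => x y.
case/sat_checker => -[x' ->].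
case/(rsat_check _ (field_lt _ _) (size_fields_leq _ _)) => h1 h2 h3 h4.
exact: check_sound h1 h2 h3 h4.
Qed.
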